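(* Let $E_x$ be an indecomposable injective right $C$-comodule such that $S_x$ is torsion-free, let $S_y$ be a simple $C$-comodule and let $n\ge1$ be an integer. If $S_y\subseteq S(S_x)/\operatorname{Soc}^nS(S_x)$, then the following assertions hold: (a) $S_y$ is torsion. (b) $S_y$ is an $n$-predecessor of $S_x$. (c) There exists a path in $\Gamma_C$ $$S_y\to S_{n-1}\to\cdots\to S_2\to S_1\to S_x$$ such that $S_i$ is torsion for all $i=1,\ldots,n-1$. If $C$ is hereditary, the converse also holds: if (a), (b) and (c) hold, then $S_y\subseteq S(S_x)/\operatorname{Soc}^nS(S_x)$.
   Context: Let $K$ be a field and $C$ a basic $K$-coalgebra (the socle of the right $C$-comodule $C$ is a direct sum of pairwise non-isomorphic simple comodules). All comodules are right comodules, $\mathcal{M}^C$ is the category of right $C$-comodules. $\{S_x\}_{x\in I_C}$ is a complete set of pairwise non-isomorphic simple right $C$-comodules, $E_x$ is the injective envelope of $S_x$. For a simple comodule $S_y$, $S_y\subseteq M$ means that $S_y$ is isomorphic to a subcomodule of $M$. $C$ is hereditary if every quotient of an injective comodule is injective. The right Ext-quiver $\Gamma_C$ has vertex set $\{S_x\}_{x\in I_C}$ and a unique arrow $S_y\to S_x$ iff $\operatorname{Ext}^1_C(S_y,S_x)\neq 0$; it is assumed connected. Loewy series: $\operatorname{Soc}^1M=\operatorname{Soc}M$ and $\operatorname{Soc}^nM/\operatorname{Soc}^{n-1}M=\operatorname{Soc}(M/\operatorname{Soc}^{n-1}M)$ for $n>1$. $S_y$ is an $n$-predecessor of $S_x$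 if $\operatorname{Ext}^1_C(S_y,\operatorname{Soc}^nE_x)\ne 0$ (equivalently $S_y\subseteq\operatorname{Soc}(E_x/\operatorname{Soc}^nE_x)$). Fix an idempotent $e\in C^*$. It acts on a right comodule $M$ by $em=\sum m_{(0)}e(m_{(1)})$, and on $C$ by $ec=\sum c_{(1)}e(c_{(2)})$, $ce=\sum e(c_{(1)})c_{(2)}$. The space $eCe$ is a coalgebra with $\Delta(ece)=\sum ec_{(1)}e\otimes ec_{(2)}e$ and counit the restriction of that of $C$. The quotient functor is the exact functor $T:\mathcal{M}^C\to\mathcal{M}^{eCe}$, $T(M)=eM\cong M\square_C eC$, and the section functor is its right adjoint $S:\mathcal{M}^{eCe}\to\mathcal{M}^C$, $S(N)=N\square_{eCe}Ce$. Put $I_e=\{x\in I_C: T(S_x)\neq0\}$. A simple comodule $S_x$ is torsion-free if $x\in I_e$ and torsion if $T(S_x)=0$. The comodules $T(S_x)$, $x\in I_e$, again denoted $S_x$, form a complete set of pairwise non-isomorphic simple $eCe$-comodules; $S(S_x)$ is the functor $S$ applied to the simple $eCe$-comodule $S_x$, and is a subcomodule of $E_x$ containing $S_x$. *)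

(* Defs.v *)
From HB Require Import structures.
From mathcomp Require Import all_boot all_algebra.
From mathcomp Require Import boolp classical_sets.
From Stdlib Require Import Relation_Operators.

Set Implicit Arguments.
Unset Strict Implicit.
Unset Printing Implicit Defensive.

Import GRing.Theory.
Local Open Scope ring_scope.
Local Open Scope quotient_scope.

(* V (x) W is the quotient of formal finite sums of pairs by the relation     *)
(* "equal under every bilinear map out of V x W".                             *)
Section Tensor.
Context (K : fieldType) (V W : lmodType K).

Definition fsum (U : lmodType K) (b : V -> W -> U) (s : seq (V * W)) : U :=
  \sum_(p <- s) b p.1 p.2.

Definition tequiv (s t : seq (V * W)) : bool :=
  `[< forall (U : lmodType K) (b : {bilinear V -> W -> U}),
        fsum b s = fsum b t >].

Lemma tequiv_is_equiv : equiv_class_of tequiv.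
Proof.
split=> [s|s t|t s u].
- by apply/asboolP.
- by apply/asboolP/asboolP => h U b.
- by move=> /asboolP h /asboolP h'; apply/asboolP => U b; rewrite h.
Qed.

Canonical tequiv_equiv := EquivRelPack tequiv_is_equiv.
Canonical tequiv_encModRel := defaultEncModRel tequiv.

Definition tensor := {eq_quot tequiv}.
HB.instance Definition _ := Choice.on tensor.
HB.instance Definition _ : EqQuotient _ tequiv tensor := EqQuotient.on tensor.

Definition tev (U : lmodType K) (b : {bilinear V -> W -> U}) (x : tensor) : U :=
  fsum b (repr x).

Lemma tev_pi (U : lmodType K) (b : {bilinear V -> W -> U}) s :
  tev b (\pi_tensor s) = fsum b s.
Proof.
rewrite /tev; have : tequiv (repr (\pi_tensor s)) s by rewrite -eqmodE reprK.
by move/asboolP; apply.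
Qed.

Lemma tensorP (x y : tensor) :
  (forall (U : lmodType K) (b : {bilinear V -> W -> U}), tev b x = tev b y) ->
  x = y.
Proof.
by move=> h; rewrite -[x]reprK -[y]reprK; apply/eqmodP/asboolP => U b; apply: h.
Qed.

Definition tzero : tensor := \pi_tensor [::].
Definition tadd (x y : tensor) : tensor := \pi_tensor (repr x ++ repr y).
Definition tscale (a : K) (x : tensor) : tensor :=
  \pi_tensor [seq (a *: p.1, p.2) | p <- repr x].
Definition topp (x : tensor) : tensor := tscale (-1) x.

Section TevE.
Context (U : lmodType K) (b : {bilinear V -> W -> U}).

Lemma tev0 : tev b tzero = 0.
Proof. by rewrite tev_pi /fsum big_nil. Qed.

Lemma tevD x y : tev b (tadd x y) = tev b x + tev b y.
Proof. by rewrite tev_pi /fsum big_cat. Qed.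

Lemma tevZ a x : tev b (tscale a x) = a *: tev b x.
Proof.
rewrite tev_pi /fsum big_map /tev /fsum scaler_sumr.
by apply: eq_bigr => p _; rewrite linearZl_LR.
Qed.

Lemma tevN x : tev b (topp x) = - tev b x.
Proof. by rewrite tevZ scaleN1r. Qed.
End TevE.

Let taddA : associative tadd.
Proof. by move=> x y z; apply: tensorP => U b; rewrite !tevD addrA. Qed.
Let taddC : commutative tadd.
Proof. by move=> x y; apply: tensorP => U b; rewrite !tevD addrC. Qed.
Let tadd0 : left_id tzero tadd.
Proof. by move=> x; apply: tensorP => U b; rewrite tevD tev0 add0r. Qed.
Let taddN : left_inverse tzero topp tadd.
Proof. by move=> x; apply: tensorP => U b; rewrite tevD tevN tev0 addNr. Qed.

HB.instance Definition _ :=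
  GRing.isZmodule.Build tensor taddA taddC tadd0 taddN.

Let tscaleA a b x : tscale a (tscale b x) = tscale (a * b) x.
Proof. by apply: tensorP => U f; rewrite !tevZ scalerA. Qed.
Let tscale1 : left_id 1 tscale.
Proof. by move=> x; apply: tensorP => U f; rewrite !tevZ scale1r. Qed.
Let tscaleDr : right_distributive tscale +%R.
Proof. by move=> a x y; apply: tensorP => U f; rewrite tevZ !tevD !tevZ scalerDr. Qed.
Let tscaleDl x : {morph tscale^~ x : a b / a + b}.
Proof. by move=> a b; apply: tensorP => U f; rewrite tevD !tevZ scalerDl. Qed.

HB.instance Definition _ :=
  GRing.Zmodule_isLmodule.Build K tensor tscaleA tscale1 tscaleDr tscaleDl.

Definition tens (v : V) (w : W) : tensor := \pi_tensor [:: (v, w)].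

Lemma tev_tens (U : lmodType K) (b : {bilinear V -> W -> U}) v w :
  tev b (tens v w) = b v w.
Proof. by rewrite tev_pi /fsum big_seq1. Qed.

Lemma tev_is_linear (U : lmodType K) (b : {bilinear V -> W -> U}) :
  linear (tev b).
Proof. by move=> a x y; rewrite tevD tevZ. Qed.
HB.instance Definition _ (U : lmodType K) (b : {bilinear V -> W -> U}) :=
  GRing.isLinear.Build K tensor U _ (tev b) (tev_is_linear b).

Lemma tens_is_bilinear : bilinear_for *:%R *:%R tens.
Proof.
split=> [w a v v'|v a w w']; apply: tensorP => U b.
- by rewrite tevD tevZ !tev_tens linearPl.
- by rewrite tevD tevZ !tev_tens linearPr.
Qed.
HB.instance Definition _ :=
  bilinear_isBilinear.Build K V W tensor _ _ tens tens_is_bilinear.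
HB.instance Definition _ (v : V) :=
  GRing.isLinear.Build K W tensor _ (tens v) (tens_is_bilinear.2 v).

Lemma tensorE (x : tensor) : x = \sum_(p <- repr x) tens p.1 p.2.
Proof.
apply: tensorP => U b; rewrite raddf_sum /tev /fsum /=.
by apply: eq_bigr => p _; rewrite -[RHS]/(tev b _) tev_tens.
Qed.

End Tensor.

Notation "V ⊗ W" := (tensor V W) (at level 40, left associativity) : type_scope.
Notation "v '⊗v' w" := (tens v w) (at level 40, left associativity) : ring_scope.

Section TensorMaps.
Context (K : fieldType).
Implicit Types U V W X : lmodType K.

Lemma tens_ext V W U (f g : {linear V ⊗ W -> U}) :
  (forall v w, f (v ⊗v w) = g (v ⊗v w)) -> f =1 g.
Proof.
move=> h x; rewrite [x]tensorE !raddf_sum; apply: eq_bigr => p _; exact: h.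
Qed.

Section Tmap.
Context V W V' W' (f : {linear V -> V'}) (g : {linear W -> W'}).
Definition tmap_fun (v : V) (w : W) : V' ⊗ W' := f v ⊗v g w.
Lemma tmap_fun_bilinear : bilinear_for *:%R *:%R tmap_fun.
Proof.
by split=> [w a v v'|v a w w']; rewrite /tmap_fun linearP ?linearPl ?linearPr.
Qed.
HB.instance Definition _ :=
  bilinear_isBilinear.Build K V W (V' ⊗ W') _ _ tmap_fun tmap_fun_bilinear.
Definition tmap : V ⊗ W -> V' ⊗ W' := tev tmap_fun.
HB.instance Definition _ := GRing.Linear.on tmap.
Lemma tmapE v w : tmap (v ⊗v w) = f v ⊗v g w.
Proof. exact: tev_tens. Qed.
End Tmap.

Lemma eq_tmap V W V' W' (f f' : {linear V -> V'}) (g g' : {linear W -> W'}) :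
  f =1 f' -> g =1 g' -> tmap f g =1 tmap f' g'.
Proof. by move=> hf hg; apply: tens_ext => v w; rewrite /= !tmapE hf hg. Qed.

Lemma tmap_comp V W V' W' V'' W'' (f : {linear V -> V'}) (g : {linear W -> W'})
    (f' : {linear V' -> V''}) (g' : {linear W' -> W''}) x :
  tmap f' g' (tmap f g x) = tmap (f' \o f) (g' \o g) x.
Proof.
move: x; apply: (@tens_ext _ _ _ (tmap f' g' \o tmap f g)) => v w.
by rewrite /= !tmapE.
Qed.

Lemma tmap_id V W (f : {linear V -> V}) (g : {linear W -> W}) :
  f =1 id -> g =1 id -> tmap f g =1 id.
Proof.
by move=> hf hg; apply: (@tens_ext _ _ _ _ idfun) => v w; rewrite /= tmapE hf hg.
Qed.

Section Tassoc.
Context U V W.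
Definition tassoc_fun (x : U ⊗ V) (w : W) : U ⊗ (V ⊗ W) :=
  tmap idfun (applyr (@tens K V W) w) x.
Lemma tassoc_fun_bilinear : bilinear_for *:%R *:%R tassoc_fun.
Proof.
split=> [w a x x'|x a w w']; first by rewrite /tassoc_fun linearP.
rewrite /tassoc_fun; move: x; apply: (@tens_ext _ _ _
  (tmap idfun (applyr (@tens K V W) (a *: w + w')))
  (a \*: tmap idfun (applyr (@tens K V W) w)
   \+ tmap idfun (applyr (@tens K V W) w'))) => u v.
by rewrite /= !tmapE /= linearPr linearPr.
Qed.
HB.instance Definition _ :=
  bilinear_isBilinear.Build K (U ⊗ V) W _ _ _ tassoc_fun tassoc_fun_bilinear.
Definition tassoc : (U ⊗ V) ⊗ W -> U ⊗ (V ⊗ W) := tev tassoc_fun.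
HB.instance Definition _ := GRing.Linear.on tassoc.
Lemma tassocE u v w : tassoc ((u ⊗v v) ⊗v w) = u ⊗v (v ⊗v w).
Proof. by rewrite /tassoc tev_tens /= /tassoc_fun tmapE. Qed.
End Tassoc.

Lemma tens_ext3 U V W X (f g : {linear (U ⊗ V) ⊗ W -> X}) :
  (forall u v w, f ((u ⊗v v) ⊗v w) = g ((u ⊗v v) ⊗v w)) -> f =1 g.
Proof.
move=> h; apply: tens_ext => x w; move: x.
pose tw : {linear U ⊗ V -> (U ⊗ V) ⊗ W} := applyr (@tens K (U ⊗ V) W) w.
apply: (@tens_ext _ _ _ (f \o tw) (g \o tw)) => u v /=; exact: h.
Qed.

Lemma tassoc_tmap U V W U' V' W' (f : {linear U -> U'}) (g : {linear V -> V'})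
    (h : {linear W -> W'}) x :
  tassoc (tmap (tmap f g) h x) = tmap f (tmap g h) (tassoc x).
Proof.
move: x; apply: (@tens_ext3 _ _ _ _ (@tassoc _ _ _ \o tmap (tmap f g) h)
  (tmap f (tmap g h) \o @tassoc _ _ _)) => u v w.
by rewrite /= tmapE /= tmapE !tassocE !tmapE /= tmapE.
Qed.

Section TassocV.
Context U V W.
Definition tassocV_fun (u : U) (y : V ⊗ W) : (U ⊗ V) ⊗ W :=
  tmap (@tens K U V u) idfun y.
Lemma tassocV_fun_bilinear : bilinear_for *:%R *:%R tassocV_fun.
Proof.
split=> [y a u u'|u a y y'] /=; last by rewrite /tassocV_fun linearP.
rewrite /tassocV_fun; move: y.
apply: (@tens_ext _ _ _ (tmap (@tens K U V (a *: u + u')) idfun)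
  (a \*: tmap (@tens K U V u) idfun \+ tmap (@tens K U V u') idfun)) => v w.
by rewrite /= !tmapE /= linearPl linearPl.
Qed.
HB.instance Definition _ :=
  bilinear_isBilinear.Build K U (V ⊗ W) _ _ _ tassocV_fun tassocV_fun_bilinear.
Definition tassocV : U ⊗ (V ⊗ W) -> (U ⊗ V) ⊗ W := tev tassocV_fun.
HB.instance Definition _ := GRing.Linear.on tassocV.
Lemma tassocVE u y : tassocV (u ⊗v y) = tmap (@tens K U V u) idfun y.
Proof. exact: tev_tens. Qed.

Lemma tassocK : cancel (@tassoc U V W) tassocV.
Proof.
apply: (@tens_ext3 _ _ _ _ (tassocV \o @tassoc U V W) idfun) => u v w.
by rewrite /= tassocE tassocVE tmapE.
Qed.

Lemma tassocVK : cancel tassocV (@tassoc U V W).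
Proof.
apply: (@tens_ext _ _ _ (@tassoc U V W \o tassocV) idfun) => u y; move: y.
apply: (@tens_ext _ _ _ (@tassoc U V W \o tassocV \o @tens K U (V ⊗ W) u)
  (@tens K U (V ⊗ W) u)) => v w.
by rewrite /= tassocVE tmapE tassocE.
Qed.
End TassocV.

(* phi (x) id and id (x) phi, after the identifications K (x) W = W and       *)
(* V (x) K = V.                                                               *)
Section Contraction.
Context V W.
Definition tcontrl_fun (phi : {scalar V}) (v : V) (w : W) : W := phi v *: w.
Definition tcontrr_fun (phi : {scalar W}) (v : V) (w : W) : V := phi w *: v.
Lemma tcontrl_fun_bilinear phi : bilinear_for *:%R *:%R (tcontrl_fun phi).
Proof.
split=> [w a v v'|v a w w']; rewrite /tcontrl_fun /=.
- by rewrite linearP scalerDl scalerA.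
- by rewrite scalerDr !scalerA mulrC.
Qed.
Lemma tcontrr_fun_bilinear phi : bilinear_for *:%R *:%R (tcontrr_fun phi).
Proof.
split=> [w a v v'|v a w w']; rewrite /tcontrr_fun /=.
- by rewrite scalerDr !scalerA mulrC.
- by rewrite linearP scalerDl scalerA.
Qed.
HB.instance Definition _ phi := bilinear_isBilinear.Build K V W W _ _
  (tcontrl_fun phi) (tcontrl_fun_bilinear phi).
HB.instance Definition _ phi := bilinear_isBilinear.Build K V W V _ _
  (tcontrr_fun phi) (tcontrr_fun_bilinear phi).
Definition tcontrl (phi : {scalar V}) : V ⊗ W -> W := tev (tcontrl_fun phi).
Definition tcontrr (phi : {scalar W}) : V ⊗ W -> V := tev (tcontrr_fun phi).
HB.instance Definition _ phi := GRing.Linear.on (tcontrl phi).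
HB.instance Definition _ phi := GRing.Linear.on (tcontrr phi).
Lemma tcontrlE phi v w : tcontrl phi (v ⊗v w) = phi v *: w.
Proof. exact: tev_tens. Qed.
Lemma tcontrrE phi v w : tcontrr phi (v ⊗v w) = phi w *: v.
Proof. exact: tev_tens. Qed.
End Contraction.

Section ContractionTheory.
Context V W V' W' (f : {linear V -> V'}) (g : {linear W -> W'}).

Lemma tcontrl_tmap (phi : {scalar V'}) (psi : {scalar V}) x :
  (forall v, phi (f v) = psi v) ->
  tcontrl phi (tmap f g x) = g (tcontrl psi x).
Proof.
move=> h; move: x.
apply: (@tens_ext _ _ _ (tcontrl phi \o tmap f g) (g \o tcontrl psi)) => v w.
by rewrite /= tmapE !tcontrlE linearZ h.
Qed.

Lemma tcontrr_tmap (phi : {scalar W'}) (psi : {scalar W}) x :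
  (forall w, phi (g w) = psi w) ->
  tcontrr phi (tmap f g x) = f (tcontrr psi x).
Proof.
move=> h; move: x.
apply: (@tens_ext _ _ _ (tcontrr phi \o tmap f g) (f \o tcontrr psi)) => v w.
by rewrite /= tmapE !tcontrrE linearZ h.
Qed.
End ContractionTheory.

Lemma tcontrr_assoc U V W (phi : {scalar W}) (x : (U ⊗ V) ⊗ W) :
  tcontrr phi x = tmap idfun (tcontrr phi) (tassoc x).
Proof.
move: x; apply: (@tens_ext3 _ _ _ _ (tcontrr phi)
  (tmap idfun (tcontrr phi) \o @tassoc _ _ _)) => u v w.
by rewrite /= tassocE tmapE /= !tcontrrE linearZr_LR.
Qed.

Lemma tcontrl_assoc U V W (phi : {scalar U}) (x : (U ⊗ V) ⊗ W) :
  tmap (tcontrl phi) idfun x = tcontrl phi (tassoc x).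
Proof.
move: x; apply: (@tens_ext3 _ _ _ _ (tmap (tcontrl phi) idfun)
  (tcontrl phi \o @tassoc _ _ _)) => u v w.
by rewrite /= tassocE tmapE /= !tcontrlE linearZl_LR.
Qed.

Section Tpair.
Context V W (phi : {scalar V}) (psi : {scalar W}).
Definition tpair_fun (v : V) (w : W) : K^o := phi v * psi w.
Lemma tpair_fun_bilinear : bilinear_for *:%R *:%R tpair_fun.
Proof.
split=> [w a v v'|v a w w']; rewrite /tpair_fun /= linearP /=.
- by rewrite mulrDl -mulrA.
- by rewrite mulrDr mulrCA.
Qed.
HB.instance Definition _ :=
  bilinear_isBilinear.Build K V W _ _ _ tpair_fun tpair_fun_bilinear.
Definition tpair : V ⊗ W -> K^o := tev tpair_fun.
HB.instance Definition _ := GRing.Linear.on tpair.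
Lemma tpairE v w : tpair (v ⊗v w) = phi v * psi w.
Proof. exact: tev_tens. Qed.
Lemma tpair_contrr x : tpair x = phi (tcontrr psi x).
Proof.
rewrite [x]tensorE (raddf_sum tpair) (raddf_sum (tcontrr psi)) (raddf_sum phi).
by apply: eq_bigr => p _; rewrite /= tpairE tcontrrE linearZ mulrC.
Qed.
Lemma tpair_contrl x : tpair x = psi (tcontrl phi x).
Proof.
rewrite [x]tensorE (raddf_sum tpair) (raddf_sum (tcontrl phi)) (raddf_sum psi).
by apply: eq_bigr => p _; rewrite /= tpairE tcontrlE linearZ.
Qed.
End Tpair.

End TensorMaps.

Section Subspaces.
Context (K : fieldType).
Implicit Types U V W : lmodType K.

Record subspace V := Subspace {
  subspace_pred :> {pred V};
  subspace_closed : submod_closed subspace_pred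
}.
HB.instance Definition _ V (N : subspace V) := GRing.isZmodClosed.Build V
  (subspace_pred N) (GRing.submod_closedB (subspace_closed N)).
HB.instance Definition _ V (N : subspace V) := GRing.isScaleClosed.Build K V
  (subspace_pred N)
  (GRing.subsemimod_closedZ (GRing.submod_closed_semi (subspace_closed N))).

Record sub_of V (N : subspace V) := SubOf { sub_val : V; _ : sub_val \in N }.
HB.instance Definition _ V (N : subspace V) := [isSub for @sub_val V N].
HB.instance Definition _ V (N : subspace V) := [Choice of sub_of N by <:].
HB.instance Definition _ V (N : subspace V) :=
  [SubChoice_isSubLmodule of sub_of N by <:].

Definition incl V (N : subspace V) : {linear sub_of N -> V} := \val.

Definition img_pred V W (f : {linear V -> W}) : {pred W} :=
  [pred w | `[< exists v, w = f v >]].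
Definition ker_pred V W (f : {linear V -> W}) : {pred V} := [pred v | f v == 0].

Lemma img_closed V W (f : {linear V -> W}) : submod_closed (img_pred f).
Proof.
split=> [|a u v]; first by apply/asboolP; exists 0; rewrite linear0.
move=> /asboolP[u' ->] /asboolP[v' ->]; apply/asboolP.
by exists (a *: u' + v'); rewrite linearP.
Qed.
Lemma ker_closed V W (f : {linear V -> W}) : submod_closed (ker_pred f).
Proof.
split=> [|a u v]; rewrite !inE ?linear0 //.
by move=> /eqP hu /eqP hv; rewrite linearP hu hv scaler0 addr0.
Qed.
Definition lin_img V W (f : {linear V -> W}) := Subspace (img_closed f).
Definition lin_ker V W (f : {linear V -> W}) := Subspace (ker_closed f).

Lemma img_in V W (f : {linear V -> W}) v : f v \in lin_img f.
Proof. by apply/asboolP; exists v. Qed.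
Definition corestr V W (f : {linear V -> W}) (v : V) : sub_of (lin_img f) :=
  SubOf (img_in f v).
Lemma corestr_linear V W (f : {linear V -> W}) : linear (corestr f).
Proof. by move=> a u v; apply: val_inj; rewrite /= linearP. Qed.
HB.instance Definition _ V W (f : {linear V -> W}) :=
  GRing.isLinear.Build K V _ _ (corestr f) (corestr_linear f).
Lemma corestr_surj V W (f : {linear V -> W}) x : exists v, x = corestr f v.
Proof.
case: x => w wP; have /asboolP[v hv] := wP.
by exists v; apply: val_inj.
Qed.

(* Linear retractions onto subspaces, by Zorn's lemma.                        *)
Lemma retraction_ex V (N : subspace V) :
  exists k : {linear V -> V}, (forall v, k v \in N) /\ {in N, k =1 id}.
Proof.
pose lin (A : set V) := forall a u v, A u -> A v -> A (a *: u + v).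
pose P (A : set V) := lin A /\ forall v, A v -> v \in N -> v = 0.
have [F FP tot|A [[Alin AN] Amax]] := @Zorn_bigcup V P.
  split=> [a u v [X FX Xu] [Y FY Yv]|v [X FX Xv] vN].
    have [XY|YX] := tot _ _ FX FY.
      by exists Y => //; apply: (FP _ FY).1 => //; apply: XY.
    by exists X => //; apply: (FP _ FX).1 => //; apply: YX.
  exact: (FP _ FX).2.
have decE v : exists n a, [/\ n \in N, A a \/ a = 0 & v = n + a].
  apply: contrapT => hv.
  pose B : set V := fun w => exists b c, (A c \/ c = 0) /\ w = b *: v + c.
  have Ac a c c' : A c \/ c = 0 -> A c' \/ c' = 0 ->
      A (a *: c + c') \/ a *: c + c' = 0.
    case=> [hc|->] [hc'|->].
    - by left; apply: Alin.
    - left; have := Alin (a - 1) c c hc hc.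
      by rewrite scalerBl scale1r subrK addr0.
    - by left; rewrite scaler0 add0r.
    - by right; rewrite scaler0 add0r.
  apply: (Amax B).
    split=> [u Au|BA]; first by exists 0, u; split; [left|rewrite scale0r add0r].
    apply: hv; exists 0, v; split; rewrite ?rpred0 ?add0r //; left; apply: BA.
    by exists 1, 0; split; [right|rewrite scale1r addr0].
  split=> [a u w [b [c [hc ->]]] [b' [c' [hc' ->]]]|w [b [c [hc ->]]] wN].
    exists (a * b + b'), (a *: c + c'); split; first exact: Ac.
    by rewrite scalerDl scalerDr scalerA addrACA.
  have [b0|b0] := eqVneq b 0.
    move: wN; rewrite b0 scale0r add0r.
    by case: hc => [hc cN|->//]; apply: AN.
  case: hv; exists (b^-1 *: (b *: v + c)), (- b^-1 *: c); split.
  - by rewrite rpredZ.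
  - by have := Ac (- b^-1) c 0 hc (or_intror (erefl _)); rewrite addr0.
  - by rewrite scalerDr scalerA mulVf // scale1r scaleNr addrK.
have uniqE n a n' a' : n \in N -> n' \in N -> (A a \/ a = 0) ->
    (A a' \/ a' = 0) -> n + a = n' + a' -> n = n'.
  move=> nN n'N ha ha' e; apply/eqP; rewrite -subr_eq0; apply/eqP.
  have e' : n - n' = a' - a.
    by apply/eqP; rewrite subr_eq addrAC eq_sym subr_eq addrC e addrC.
  have dN : n - n' \in N by rewrite rpredB.
  have : A (a' - a) \/ a' - a = 0.
    case: ha => [ha|->]; case: ha' => [ha'|->].
    - by left; have := Alin (-1) _ _ ha ha'; rewrite scaleN1r addrC.
    - left; have := Alin (-2) _ _ ha ha.
      by rewrite scaleNr scaler_nat mulr2n opprD addrNK sub0r.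
    - by left; rewrite subr0.
    - by right; rewrite subrr.
  by rewrite -e' => -[/AN|->//]; apply.
have [k0 k0P] := choice decE.
have k0N v : k0 v \in N by have [a []] := k0P v.
have k0E v n a : n \in N -> A a \/ a = 0 -> v = n + a -> k0 v = n.
  move=> nN ha hv; have [a' [h1 h2 h3]] := k0P v.
  by apply: (uniqE _ a' _ a) => //; rewrite -h3.
have k0lin : linear k0.
  move=> b u v; have [a [h1 h2 h3]] := k0P u; have [a' [h1' h2' h3']] := k0P v.
  apply: (@k0E _ _ (b *: a + a')).
  - by rewrite rpredD ?rpredZ.
  - case: h2 => [h2|->]; case: h2' => [h2'|->]; rewrite ?scaler0 ?add0r.
    + by left; apply: Alin.
    + left; have := Alin (b - 1) _ _ h2 h2.
      by rewrite scalerBl scale1r subrK addr0.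
    + by left.
    + by right.
  - by rewrite {1}h3 {1}h3' scalerDr addrACA.
pose k : {linear V -> V} := HB.pack k0 (GRing.isLinear.Build K V V _ k0 k0lin).
exists k; split=> // v vN; apply: (@k0E _ _ 0) => //; first by right.
by rewrite addr0.
Qed.

Lemma retract_ex V (N : subspace V) :
  exists k : {linear V -> sub_of N}, forall x, k (incl N x) = x.
Proof.
have [k [kN kid]] := retraction_ex N.
pose k1 v := SubOf (kN v).
have k1lin : linear k1 by move=> a u v; apply: val_inj; rewrite /= linearP.
pose k2 : {linear V -> sub_of N} :=
  HB.pack k1 (GRing.isLinear.Build K V _ _ k1 k1lin).
exists k2 => x.
by apply: val_inj; rewrite /= kid //; case: x.
Qed.

Lemma quasi_inverse_ex V W (f : {linear V -> W}) :
  exists g : {linear W -> V}, forall v, f (g (f v)) = f v.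
Proof.
have [k [kN kid]] := retraction_ex (lin_ker f).
have [k' [kI kid']] := retraction_ex (lin_img f).
have /choice[h hE] : forall w, exists v, k' w = f v.
  by move=> w; have /asboolP := kI w.
pose g0 w := h w - k (h w).
have fk v : f (k v) = 0 by apply/eqP; have := kN v; rewrite inE.
have same v v' : f v = f v' -> v - k v = v' - k v'.
  move=> e; have /kid e' : v - v' \in lin_ker f by rewrite inE linearB e subrr.
  have -> : k v = v - v' + k v' by rewrite -[v - v']e' linearB subrK.
  by rewrite opprD opprB addrA [v + _]addrC subrK.
have g0lin : linear g0.
  move=> a u v; rewrite /g0 (same _ (a *: h u + h v)).
    by rewrite linearP scalerBr opprD addrACA.
  by rewrite linearP -!hE linearP.
pose g : {linear W -> V} := HB.pack g0 (GRing.isLinear.Build K W V _ g0 g0lin).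
exists g => v /=.
by rewrite /g0 linearB fk subr0 -hE kid' // img_in.
Qed.

Definition lquot V (N : subspace V) : Type :=
  Quotient.quot (subspace_pred N : zmodClosed V).
HB.instance Definition _ V (N : subspace V) := GRing.Zmodule.on (lquot N).
HB.instance Definition _ V (N : subspace V) :=
  EqQuotient.on (lquot N).

Section Lquot.
Context V (N : subspace V).
Definition lproj (v : V) : lquot N := \pi_(lquot N) v.

Lemma lproj_eq v w : lproj v = lproj w <-> v - w \in N.
Proof.
rewrite (_ : (v - w \in N) = (lproj v == lproj w)).
  by split=> [->|/eqP].
by rewrite -[RHS]/(v == w %[mod lquot N]) -Quotient.idealrBE.
Qed.

Definition lquot_scale a (x : lquot N) : lquot N := lproj (a *: repr x).

Lemma lquot_scaleE a v : lquot_scale a (lproj v) = lproj (a *: v).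
Proof.
apply/lproj_eq; rewrite -scalerBr rpredZ //; apply/lproj_eq; exact: reprK.
Qed.

Lemma lprojD v w : lproj (v + w) = lproj v + lproj w.
Proof. exact: (raddfD \pi_(Quotient.quot (subspace_pred N : zmodClosed V))). Qed.

Lemma lproj_surj x : exists v, x = lproj v.
Proof. by exists (repr x); rewrite /lproj reprK. Qed.

Let sA a b x : lquot_scale a (lquot_scale b x) = lquot_scale (a * b) x.
Proof. by have [v ->] := lproj_surj x; rewrite !lquot_scaleE scalerA. Qed.
Let s1 : left_id 1 lquot_scale.
Proof. by move=> x; have [v ->] := lproj_surj x; rewrite lquot_scaleE scale1r. Qed.
Let sDr : right_distributive lquot_scale +%R.
Proof.
move=> a x y; have [v ->] := lproj_surj x; have [w ->] := lproj_surj y.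
by rewrite -lprojD !lquot_scaleE -lprojD scalerDr.
Qed.
Let sDl x : {morph lquot_scale^~ x : a b / a + b}.
Proof.
move=> a b; have [v ->] := lproj_surj x.
by rewrite !lquot_scaleE -lprojD scalerDl.
Qed.
HB.instance Definition _ :=
  GRing.Zmodule_isLmodule.Build K (lquot N) sA s1 sDr sDl.

Lemma lproj_linear : linear lproj.
Proof. by move=> a v w; rewrite lprojD -lquot_scaleE. Qed.
HB.instance Definition _ := GRing.isLinear.Build K V (lquot N) _ lproj lproj_linear.

Lemma lproj_eq0 v : lproj v = 0 <-> v \in N.
Proof. by rewrite -(linear0 lproj) lproj_eq subr0. Qed.

Context U (h : {linear V -> U}) (h0 : forall v, v \in N -> h v = 0).
Definition lquot_lift of (forall v, v \in N -> h v = 0) :=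
  fun x : lquot N => h (repr x).
Lemma lquot_liftE v : lquot_lift h0 (lproj v) = h v.
Proof.
apply/eqP; rewrite -subr_eq0 -linearB; apply/eqP/h0/lproj_eq; exact: reprK.
Qed.
Lemma lquot_lift_linear : linear (lquot_lift h0).
Proof.
move=> a x y; have [v ->] := lproj_surj x; have [w ->] := lproj_surj y.
by rewrite -linearP !lquot_liftE linearP.
Qed.
HB.instance Definition _ :=
  GRing.isLinear.Build K (lquot N) U _ (lquot_lift h0) lquot_lift_linear.
End Lquot.

Definition in_tensl V W (N : subspace V) (x : V ⊗ W) : Prop :=
  exists2 s : seq (V * W), (forall p, p \in s -> p.1 \in N) &
    x = \sum_(p <- s) p.1 ⊗v p.2.

Lemma in_tenslP V W (N : subspace V) (x : V ⊗ W) :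
  in_tensl N x <-> exists y, x = tmap (incl N) idfun y.
Proof.
split=> [[s sN ->]|[y ->]].
  elim: s sN => [|p s IH] sN; first by exists 0; rewrite linear0 big_nil.
  have [|y hy] := IH; first by move=> q qs; apply: sN; rewrite inE qs orbT.
  have pN : p.1 \in N by apply: sN; rewrite mem_head.
  exists (SubOf pN ⊗v p.2 + y).
  by rewrite big_cons hy linearD /= tmapE.
rewrite [y]tensorE raddf_sum.
exists [seq (incl N p.1, p.2) | p <- repr y].
  by move=> q /mapP[p _ ->]; case: p => [[]].
by rewrite big_map; apply: eq_bigr => p _; rewrite /= tmapE.
Qed.

(* Exactness of - (x) W over a field.                                         *)
Lemma tmap_ker V V' W (f : {linear V -> V'}) (x : V ⊗ W) :
  tmap f idfun x = 0 -> in_tensl (lin_ker f) x.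
Proof.
move=> fx; have [g gP] := quasi_inverse_ex f; apply/in_tenslP.
pose d v : V := v - g (f v).
have dker v : d v \in lin_ker f by rewrite inE linearB gP subrr.
pose d1 v : sub_of (lin_ker f) := SubOf (dker v).
have d1lin : linear d1.
  move=> a u v; apply: val_inj; rewrite /= /d (linearP f) /= (linearP g) scalerBr.
  by rewrite opprD addrACA.
pose d1L : {linear V -> sub_of (lin_ker f)} :=
  HB.pack d1 (GRing.isLinear.Build K V _ _ d1 d1lin).
exists (tmap d1L idfun x); rewrite tmap_comp.
suff -> : tmap (incl (lin_ker f) \o d1L) (idfun \o idfun) x
    = x - tmap g idfun (tmap f idfun x) by rewrite fx linear0 subr0.
rewrite tmap_comp; move: x {fx}.
apply: (@tens_ext _ _ _ _ (tmap (incl (lin_ker f) \o d1L) (idfun \o idfun))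
  (idfun \- tmap (g \o f) (idfun \o idfun))) => v w.
by rewrite /= !tmapE /= -linearBl.
Qed.

End Subspaces.

Record coalgebra (K : fieldType) := Coalgebra {
  coalg_sort :> lmodType K;
  comult : {linear coalg_sort -> coalg_sort ⊗ coalg_sort};
  counit : {scalar coalg_sort};
  comultA : forall c,
    tassoc (tmap comult idfun (comult c)) = tmap idfun comult (comult c);
  counitl : forall c, tcontrl counit (comult c) = c;
  counitr : forall c, tcontrr counit (comult c) = c
}.
Arguments comult {K} C : rename.
Arguments counit {K} C : rename.

Section Comodules.
Context (K : fieldType).

Record comodule (C : coalgebra K) := Comodule {
  comod_sort :> lmodType K;
  coact : {linear comod_sort -> comod_sort ⊗ C};
  coactA : forall m,
    tassoc (tmap coact idfun (coact m)) = tmap idfun (comult C) (coact m);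
  coact1 : forall m, tcontrr (counit C) (coact m) = m
}.
Arguments coact {C} M : rename.

Context (C : coalgebra K).
Implicit Types M N X Y : comodule C.

Definition regular_comod : comodule C := Comodule (@comultA K C) (@counitr K C).

Record comod_hom M N := ComodHom {
  comod_fun :> {linear M -> N};
  comod_homP : forall m, coact N (comod_fun m) = tmap comod_fun idfun (coact M m)
}.

Definition comod_iso M N := exists f : comod_hom M N, bijective f.
Definition comod_embeds M N := exists f : comod_hom M N, injective f.

Record subcomodule M := Subcomodule {
  subcomod_space :> subspace M;
  subcomodP : forall m, m \in subcomod_space ->
    in_tensl subcomod_space (coact M m)
}.

(* Some retraction is needed to write the coaction of N as a linear map; the  *)
(* result does not depend on it, by sub_coactE.                               *)
Section SubcomoduleComodule.
Context M (N : subcomodule M).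

Definition sub_retract : {linear M -> sub_of N} :=
  projT1 (cid (retract_ex N)).
Lemma sub_retractK x : sub_retract (incl N x) = x.
Proof. exact: (projT2 (cid (retract_ex N))). Qed.

Definition sub_coact (x : sub_of N) : sub_of N ⊗ C :=
  tmap sub_retract idfun (coact M (incl N x)).
HB.instance Definition _ := GRing.Linear.copy sub_coact
  (tmap sub_retract idfun \o coact M \o incl N).

Lemma sub_coactE x : tmap (incl N) idfun (sub_coact x) = coact M (incl N x).
Proof.
have /in_tenslP[y hy] : in_tensl N (coact M (incl N x)).
  by apply: subcomodP; case: x.
rewrite /sub_coact hy; congr tmap; rewrite tmap_comp.
by apply: tmap_id => // z /=; apply: sub_retractK.
Qed.

Lemma tmap_incl_inj (W : lmodType K) :
  injective (tmap (incl N) (idfun : {linear W -> W})).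
Proof.
apply: (can_inj (g := tmap sub_retract idfun)) => x.
by rewrite tmap_comp; apply: tmap_id => // z /=; apply: sub_retractK.
Qed.

Lemma sub_coactA x :
  tassoc (tmap sub_coact idfun (sub_coact x))
  = tmap idfun (comult C) (sub_coact x).
Proof.
apply: tmap_incl_inj.
transitivity (tassoc (tmap (tmap (incl N) idfun) idfun
  (tmap sub_coact idfun (sub_coact x)))).
  rewrite tassoc_tmap; apply: eq_tmap => // z.
  by rewrite /= tmap_id.
rewrite tmap_comp.
rewrite (@eq_tmap _ _ _ _ _ _ (coact M \o incl N) _ (idfun \o idfun)) //;
  last exact: sub_coactE.
rewrite -tmap_comp sub_coactE coactA -sub_coactE !tmap_comp.
exact: eq_tmap.
Qed.

Lemma sub_coact1 x : tcontrr (counit C) (sub_coact x) = x.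
Proof.
apply: val_inj; rewrite -[RHS](coact1 (incl N x)) -sub_coactE.
by rewrite (@tcontrr_tmap _ _ _ _ _ _ _ _ (counit C)).
Qed.

Definition sub_comod : comodule C := Comodule sub_coactA sub_coact1.
Definition sub_incl : comod_hom sub_comod M :=
  @ComodHom sub_comod M (incl N) (fun x => esym (sub_coactE x)).
End SubcomoduleComodule.
Coercion sub_comod : subcomodule >-> comodule.

Section QuotientComodule.
Context M (N : subcomodule M).

Definition quot_pre (m : M) : lquot N ⊗ C :=
  tmap (@lproj _ _ N) idfun (coact M m).
HB.instance Definition _ := GRing.Linear.copy quot_pre
  (tmap (@lproj _ _ N) idfun \o coact M).

Lemma quot_pre0 m : m \in N -> quot_pre m = 0.
Proof.
move=> /subcomodP /in_tenslP[y hy]; rewrite /quot_pre hy tmap_comp [y]tensorE raddf_sum.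
apply: big1 => p _; rewrite /= tmapE /=.
suff -> : lproj N (incl N p.1) = 0 by rewrite linear0l.
by apply/lproj_eq0; case: p => [[]].
Qed.

Definition quot_coact : lquot N -> lquot N ⊗ C := lquot_lift quot_pre0.
HB.instance Definition _ := GRing.Linear.on quot_coact.

Lemma quot_coactE m :
  quot_coact (lproj N m) = tmap (@lproj _ _ N) idfun (coact M m).
Proof. exact: lquot_liftE. Qed.

Lemma quot_coactA x :
  tassoc (tmap quot_coact idfun (quot_coact x))
  = tmap idfun (comult C) (quot_coact x).
Proof.
have [m ->] := lproj_surj x.
rewrite quot_coactE tmap_comp.
rewrite (@eq_tmap _ _ _ _ _ _ (tmap (@lproj _ _ N) idfun \o coact M) _
  (idfun \o idfun)) //; last exact: quot_coactE.
rewrite -tmap_comp tassoc_tmap coactA !tmap_comp; apply: eq_tmap => // c.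
by rewrite /= tmap_id.
Qed.

Lemma quot_coact1 x : tcontrr (counit C) (quot_coact x) = x.
Proof.
have [m ->] := lproj_surj x; rewrite quot_coactE.
by rewrite (@tcontrr_tmap _ _ _ _ _ _ _ _ (counit C)) ?coact1.
Qed.

Definition quot_comod : comodule C := Comodule quot_coactA quot_coact1.
Definition quot_proj : comod_hom M quot_comod :=
  @ComodHom M quot_comod (@lproj _ _ N) quot_coactE.
End QuotientComodule.

Lemma hom_ker_subcomod M N (f : comod_hom M N) m :
  m \in lin_ker f -> in_tensl (lin_ker f) (coact M m).
Proof.
rewrite inE => /eqP fm; apply: tmap_ker.
by rewrite -comod_homP fm linear0.
Qed.
Definition hom_ker M N (f : comod_hom M N) : subcomodule M :=
  Subcomodule (@hom_ker_subcomod M N f).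

Lemma in_tenslD (V W : lmodType K) (N : subspace V) (x y : V ⊗ W) :
  in_tensl N x -> in_tensl N y -> in_tensl N (x + y).
Proof.
move=> /in_tenslP[x' ->] /in_tenslP[y' ->]; apply/in_tenslP.
by exists (x' + y'); rewrite linearD.
Qed.

Lemma in_tensl_mono (V W : lmodType K) (N N' : subspace V) (x : V ⊗ W) :
  (forall v, v \in N -> v \in N') -> in_tensl N x -> in_tensl N' x.
Proof. by move=> h [s hs ->]; exists s => // p /hs /h. Qed.

Definition simple_comod M :=
  (exists m : M, m != 0) /\
  forall N : subcomodule M,
    (forall m, m \in N -> m = 0) \/ (forall m, m \in N).

Section Socle.
Context M.

Definition socle_pred : {pred M} := [pred m | `[< exists2 s : seq M,
  (forall u, u \in s -> exists2 N : subcomodule M, simple_comod N & u \in N) &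
  m = \sum_(u <- s) u >]].

Lemma socle_closed : submod_closed socle_pred.
Proof.
split=> [|a u v]; first by apply/asboolP; exists [::]; rewrite ?big_nil.
move=> /asboolP[s hs ->] /asboolP[t ht ->]; apply/asboolP.
exists ([seq a *: w | w <- s] ++ t).
  move=> w; rewrite mem_cat => /orP[/mapP[w' /hs[N Ns w'N] ->]|/ht//].
  by exists N; rewrite ?rpredZ.
by rewrite big_cat big_map scaler_sumr.
Qed.
Definition socle_space := Subspace socle_closed.

Lemma socle_subcomod m : m \in socle_space -> in_tensl socle_space (coact M m).
Proof.
move=> /asboolP[s hs ->]; elim: s hs => [|u s IH] hs.
  by rewrite big_nil linear0; exists [::]; rewrite ?big_nil.
rewrite big_cons linearD; apply: in_tenslD; last first.
  by apply: IH => v vs; apply: hs; rewrite inE vs orbT.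
have [N Ns uN] := hs u (mem_head _ _).
apply: in_tensl_mono (subcomodP uN) => v vN; apply/asboolP.
by exists [:: v]; rewrite ?big_seq1// => w; rewrite inE => /eqP->; exists N.
Qed.
Definition comod_socle : subcomodule M := Subcomodule socle_subcomod.
End Socle.

Lemma zero_closed M : submod_closed (pred1 (0 : M)).
Proof.
by split=> [|a u v]; rewrite !inE // => /eqP-> /eqP->; rewrite scaler0 addr0.
Qed.
Lemma zero_subcomodP M m : m \in Subspace (zero_closed M) ->
  in_tensl (Subspace (zero_closed M)) (coact M m).
Proof.
by rewrite inE => /eqP->; rewrite linear0; exists [::]; rewrite ?big_nil.
Qed.
Definition zero_subcomod M : subcomodule M := Subcomodule (@zero_subcomodP M).

Section Preimage.
Context M Q (f : comod_hom M Q) (N : subcomodule Q).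

Definition preim_pred : {pred M} := [pred m | f m \in N].
Lemma preim_closed : submod_closed preim_pred.
Proof.
split=> [|a u v]; rewrite !inE ?linear0 ?rpred0 // => hu hv.
by rewrite linearP rpredD ?rpredZ.
Qed.
Lemma preim_subcomodP m : m \in Subspace preim_closed ->
  in_tensl (Subspace preim_closed) (coact M m).
Proof.
move=> fmN; pose h : {linear M -> lquot N} := @lproj _ _ N \o f.
have hE v : (v \in lin_ker h) = (f v \in N).
  by rewrite inE; apply/eqP/idP => /lproj_eq0.
apply: (@in_tensl_mono _ _ (lin_ker h)) => [v|]; first by rewrite hE.
apply: tmap_ker; rewrite (@eq_tmap _ _ _ _ _ h (@lproj _ _ N \o f)
  idfun (idfun \o idfun)) // -tmap_comp -comod_homP -quot_coactE.
by rewrite (proj2 (lproj_eq0 N (f m)) fmN) linear0.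
Qed.
Definition preim_subcomod : subcomodule M := Subcomodule preim_subcomodP.
End Preimage.

(* loewy M n is Soc^n M, with Soc^0 M = 0.                                    *)
Fixpoint loewy M (n : nat) : subcomodule M :=
  match n with
  | 0 => zero_subcomod M
  | 1 => comod_socle M
  | (_.+1 as n').+1 =>
      preim_subcomod (quot_proj (loewy M n')) (comod_socle (quot_comod (loewy M n')))
  end.

Definition injective_comod X :=
  forall (M N : comodule C) (i : comod_hom M N) (f : comod_hom M X),
    injective i -> exists g : comod_hom N X, forall m, g (i m) = f m.

Definition essential M X (i : comod_hom M X) :=
  forall N : subcomodule X,
    (forall m, i m \in N -> i m = 0) -> forall x, x \in N -> x = 0.

Definition injective_envelope M X (i : comod_hom M X) :=
  [/\ injective_comod X, injective i & essential i].

Definition hereditary_coalg :=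
  forall X, injective_comod X ->
  forall N : subcomodule X, injective_comod (quot_comod N).

Definition internal_direct_sum M (I : eqType) (F : I -> subcomodule M)
    (N : subcomodule M) :=
  (forall m, m \in N <-> exists (s : seq I) (u : I -> M),
     (forall i, u i \in F i) /\ m = \sum_(i <- s) u i) /\
  (forall (s : seq I) (u : I -> M), uniq s -> (forall i, u i \in F i) ->
     \sum_(i <- s) u i = 0 -> forall i, i \in s -> u i = 0).

Definition basic_coalg := exists (I : eqType) (F : I -> subcomodule regular_comod),
  [/\ forall i, simple_comod (F i),
      forall i j, i != j -> ~ comod_iso (F i) (F j) &
      internal_direct_sum F (comod_socle regular_comod)].

Definition complete_simples (I : Type) (S : I -> comodule C) :=
  [/\ forall x, simple_comod (S x),
      forall x y, comod_iso (S x) (S y) -> x = y &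
      forall M, simple_comod M -> exists x, comod_iso M (S x)].

(* Ext^1(A, B) is Yoneda's: the classes of extensions of A by B, the zero     *)
(* class being that of the split ones.                                        *)
Record extension (A B : comodule C) := Extension {
  ext_mid : comodule C;
  ext_inj : comod_hom B ext_mid;
  ext_proj : comod_hom ext_mid A;
  ext_inj_inj : injective ext_inj;
  ext_proj_surj : forall a, exists x, ext_proj x = a;
  ext_exact : forall x, ext_proj x = 0 <-> exists b, x = ext_inj b
}.

Definition ext_split A B (X : extension A B) :=
  exists s : comod_hom A (ext_mid X), forall a, ext_proj X (s a) = a.

Definition Ext1_neq0 (A B : comodule C) :=
  exists X : extension A B, ~ ext_split X.

Section Quiver.
Context (I : Type) (S : I -> comodule C).

Definition ext_arrow (y x : I) := Ext1_neq0 (S y) (S x).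

Definition ext_connected := forall x y : I,
  clos_refl_sym_trans I ext_arrow x y.

(* p 0 = x, p n = y, and p n -> ... -> p 1 -> p 0; P holds at p 1, ..,        *)
(* p (n - 1).                                                                 *)
Definition ext_path_through (P : I -> Prop) (n : nat) (y x : I) :=
  exists p : nat -> I,
    [/\ p 0%N = x, p n = y,
        forall i, (i < n)%N -> ext_arrow (p i.+1) (p i) &
        forall i, (0 < i < n)%N -> P (p i)].
End Quiver.

(* S_y is an n-predecessor of S_x, where Ex is the injective envelope of S_x. *)
Definition predecessor (n : nat) (Sy Ex : comodule C) :=
  Ext1_neq0 Sy (loewy Ex n).

End Comodules.
Arguments coact {K C} M : rename.
Arguments regular_comod {K} C.
Arguments basic_coalg {K} C.
Arguments hereditary_coalg {K} C.

(* V (x) P with coaction id (x) rho, up to associativity.                     *)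
Section TensorComodule.
Context (K : fieldType) (C : coalgebra K) (V : lmodType K) (P : comodule C).

Definition tens_coact (x : V ⊗ P) : (V ⊗ P) ⊗ C :=
  tassocV (tmap idfun (coact P) x).
HB.instance Definition _ := GRing.Linear.copy tens_coact
  (@tassocV _ _ _ _ \o tmap idfun (coact P)).

Lemma tens_coactE v p :
  tens_coact (v ⊗v p) = tmap (@tens K V P v) idfun (coact P p).
Proof. by rewrite /tens_coact tmapE tassocVE. Qed.

Lemma tens_coactA x :
  tassoc (tmap tens_coact idfun (tens_coact x))
  = tmap idfun (comult C) (tens_coact x).
Proof.
move: x; apply: (@tens_ext _ _ _ _
  (@tassoc _ _ _ _ \o tmap tens_coact idfun \o tens_coact)
  (tmap idfun (comult C) \o tens_coact)) => v p.
rewrite /= tens_coactE tmap_comp.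
rewrite (@eq_tmap _ _ _ _ _ _ (tmap (@tens K V P v) idfun \o coact P) _
  (idfun \o idfun)) //; last exact: tens_coactE.
rewrite -tmap_comp tassoc_tmap coactA !tmap_comp; apply: eq_tmap => // c.
by rewrite /= tmap_id.
Qed.

Lemma tens_coact1 x : tcontrr (counit C) (tens_coact x) = x.
Proof.
move: x; apply: (@tens_ext _ _ _ _ (tcontrr (counit C) \o tens_coact) idfun).
move=> v p; rewrite /= tens_coactE.
by rewrite (@tcontrr_tmap _ _ _ _ _ _ _ _ (counit C)) ?coact1.
Qed.

Definition tens_comod : comodule C := Comodule tens_coactA tens_coact1.
End TensorComodule.

Section Cotensor.
Context (K : fieldType) (D C : coalgebra K).

Record bicomodule := Bicomodule {
  bicomod_right :> comodule C;
  lcoact : {linear bicomod_right -> D ⊗ bicomod_right};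
  lcoactA : forall p,
    tassoc (tmap (comult D) idfun (lcoact p)) = tmap idfun lcoact (lcoact p);
  lcoact1 : forall p, tcontrl (counit D) (lcoact p) = p;
  bicomodP : forall p,
    tassoc (tmap lcoact idfun (coact bicomod_right p))
    = tmap idfun (coact bicomod_right) (lcoact p)
}.

Context (N : comodule D) (P : bicomodule).

Definition cotensor_map : {linear N ⊗ P -> N ⊗ (D ⊗ P)} :=
  (@tassoc _ _ _ _ \o tmap (coact N) idfun) \- tmap idfun (lcoact P).

Lemma cotensor_mapP x :
  @tens_coact _ _ N (tens_comod D P) (cotensor_map x)
  = tmap cotensor_map idfun (@tens_coact _ _ N P x).
Proof.
move: x; apply: (@tens_ext _ _ _ _
  (@tens_coact _ _ N (tens_comod D P) \o cotensor_map)
  (tmap cotensor_map idfun \o @tens_coact _ _ N P)) => n p.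
pose fn : {linear P -> N ⊗ (D ⊗ P)} :=
  @tassoc _ _ _ _ \o @tens K (N ⊗ D) P (coact N n).
pose gn : {linear P -> N ⊗ (D ⊗ P)} := @tens K N (D ⊗ P) n \o lcoact P.
transitivity (tmap fn idfun (coact P p) - tmap gn idfun (coact P p)).
  rewrite /= linearB /= !tmapE; congr (_ - _).
    rewrite -[RHS]/(tmap fn idfun (coact P p)).
    rewrite (@eq_tmap _ _ _ _ _ _ fn _ (idfun \o idfun)) // -tmap_comp.
    rewrite -tassocVE; move: (coact N n).
    apply: (@tens_ext _ _ _ _
      (@tens_coact _ _ N (tens_comod D P) \o @tassoc _ _ _ _
        \o applyr (@tens K (N ⊗ D) P) p)
      (tmap (@tassoc _ _ _ _) idfun \o @tassocV _ _ _ _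
        \o applyr (@tens K (N ⊗ D) (P ⊗ C)) (coact P p))) => n' d.
    rewrite /= tassocE tens_coactE tassocVE /= tens_coactE !tmap_comp.
    by apply: eq_tmap => // p' /=; rewrite tassocE.
  rewrite tens_coactE /= {1}/tens_coact -bicomodP tassocK tmap_comp.
  exact: eq_tmap.
rewrite /= tens_coactE tmap_comp; move: (coact P p).
apply: (@tens_ext _ _ _ _ (tmap fn idfun \- tmap gn idfun)
  (tmap (cotensor_map \o @tens K N P n) (idfun \o idfun))) => p' c.
by rewrite /= !tmapE /= !tmapE -linearBl.
Qed.

Definition cotensor_hom :
    comod_hom (tens_comod N P) (tens_comod N (tens_comod D P)) :=
  @ComodHom _ _ (tens_comod N P) (tens_comod N (tens_comod D P))
    cotensor_map cotensor_mapP.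

(* The kernel of rho_N (x) id - id (x) lambda_P in N (x) P, with the right    *)
(* coaction of P.                                                             *)
Definition cotensor : comodule C := hom_ker cotensor_hom.

End Cotensor.

Section Idempotent.
Context (K : fieldType) (C : coalgebra K).

Definition conv (f g : {scalar C}) (c : C) : K := tpair f g (comult C c).

Record idempotent_form := Idempotent {
  idem_form :> {scalar C};
  idemP : forall c, conv idem_form idem_form c = idem_form c
}.

Context (e : idempotent_form).

(* em = sum m_(0) e(m_(1)); for M = C this is ec.                             *)
Definition acte (M : comodule C) (m : M) : M := tcontrr e (coact M m).
HB.instance Definition _ M := GRing.Linear.copy (@acte M)
  (tcontrr e \o coact M).

(* ce = sum e(c_(1)) c_(2)                                                    *)
Definition racte (c : C) : C := tcontrl e (comult C c).
HB.instance Definition _ := GRing.Linear.copy racte (tcontrl e \o comult C).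

Notation lact := (@acte (regular_comod C)).

Lemma e_lact c : e (lact c) = e c.
Proof. by rewrite /acte -tpair_contrr -[RHS]idemP. Qed.

Lemma e_ract c : e (racte c) = e c.
Proof. by rewrite /racte -tpair_contrl -[RHS]idemP. Qed.

Lemma coact_act (M : comodule C) (m : M) : coact M (acte m) = tmap idfun lact (coact M m).
Proof.
rewrite /acte -(@tcontrr_tmap _ _ _ _ _ (coact M) idfun e) //.
rewrite tcontrr_assoc coactA tmap_comp; exact: eq_tmap.
Qed.

Lemma comult_ract c : comult C (racte c) = tmap racte idfun (comult C c).
Proof.
rewrite /racte -(@tcontrl_tmap _ _ _ _ _ idfun (comult C) e e) //.
rewrite -comultA -tcontrl_assoc tmap_comp; exact: eq_tmap.
Qed.

Lemma act_idem (M : comodule C) (m : M) : acte (acte m) = acte m.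
Proof.
rewrite {1}/acte coact_act (@tcontrr_tmap _ _ _ _ _ _ _ _ e) // => c.
exact: e_lact.
Qed.

Lemma ract_idem c : racte (racte c) = racte c.
Proof.
rewrite {1}/racte comult_ract (@tcontrl_tmap _ _ _ _ _ _ _ _ e) // => d.
exact: e_ract.
Qed.

Lemma lact_ract c : lact (racte c) = racte (lact c).
Proof.
rewrite /acte /= comult_ract (@tcontrr_tmap _ _ _ _ _ _ _ _ e) //.
Qed.

Lemma e_counit_lact c : counit C (lact c) = e c.
Proof.
by rewrite /acte /= -tpair_contrr tpair_contrl counitl.
Qed.

Definition biact (c : C) : C := lact (racte c).
HB.instance Definition _ := GRing.Linear.copy biact (lact \o racte).

Lemma biact_lact c : biact (lact c) = biact c.
Proof. by rewrite /biact -lact_ract act_idem. Qed.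
Lemma biact_ract c : biact (racte c) = biact c.
Proof. by rewrite /biact ract_idem. Qed.

Definition eCe_type := sub_of (lin_img biact).
Definition eCe_proj : C -> eCe_type := corestr biact.
HB.instance Definition _ := GRing.Lmodule.on eCe_type.
HB.instance Definition _ := GRing.Linear.on eCe_proj.

Lemma eCe_proj_lact c : eCe_proj (lact c) = eCe_proj c.
Proof. by apply: val_inj; rewrite /= biact_lact. Qed.
Lemma eCe_proj_ract c : eCe_proj (racte c) = eCe_proj c.
Proof. by apply: val_inj; rewrite /= biact_ract. Qed.

Definition eCe_comult (x : eCe_type) : eCe_type ⊗ eCe_type :=
  tmap eCe_proj eCe_proj (comult C (\val x)).
HB.instance Definition _ := GRing.Linear.copy eCe_comult
  (tmap eCe_proj eCe_proj \o comult C \o incl (lin_img biact)).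

Lemma eCe_comultE c :
  eCe_comult (eCe_proj c) = tmap eCe_proj eCe_proj (comult C c).
Proof.
rewrite /eCe_comult /= /biact (@coact_act (regular_comod C)) /= comult_ract !tmap_comp.
apply: eq_tmap => d /=; [exact: eCe_proj_ract|exact: eCe_proj_lact].
Qed.

Definition eCe_counit (x : eCe_type) : K := counit C (\val x).
HB.instance Definition _ := GRing.Linear.copy eCe_counit
  (counit C \o incl (lin_img biact)).
Lemma eCe_counitE c : eCe_counit (eCe_proj c) = e c.
Proof. by rewrite /eCe_counit /= /biact e_counit_lact e_ract. Qed.

Lemma eCe_comultA x :
  tassoc (tmap eCe_comult idfun (eCe_comult x))
  = tmap idfun eCe_comult (eCe_comult x).
Proof.
have [c ->] := corestr_surj x; rewrite -/(eCe_proj c) eCe_comultE tmap_comp.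
rewrite (@eq_tmap _ _ _ _ _ _ (tmap eCe_proj eCe_proj \o comult C) _
  (eCe_proj \o idfun)) //; last exact: eCe_comultE.
rewrite -tmap_comp tassoc_tmap comultA !tmap_comp; apply: eq_tmap => // d /=.
by rewrite eCe_comultE.
Qed.

Lemma eCe_counitl x : tcontrl eCe_counit (eCe_comult x) = x.
Proof.
have [c ->] := corestr_surj x; rewrite -/(eCe_proj c) eCe_comultE.
rewrite (@tcontrl_tmap _ _ _ _ _ _ _ _ e); last exact: eCe_counitE.
exact: eCe_proj_ract.
Qed.

Lemma eCe_counitr x : tcontrr eCe_counit (eCe_comult x) = x.
Proof.
have [c ->] := corestr_surj x; rewrite -/(eCe_proj c) eCe_comultE.
rewrite (@tcontrr_tmap _ _ _ _ _ _ _ _ e); last exact: eCe_counitE.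
exact: eCe_proj_lact.
Qed.

Definition eCe : coalgebra K := Coalgebra eCe_comultA eCe_counitl eCe_counitr.

(* T(M) = eM, with em |-> sum em_(0) (x) e m_(1) e.                           *)
Section QuotientFunctor.
Context (M : comodule C).

Definition eM_type := sub_of (lin_img (@acte M)).
Definition eM_proj : M -> eM_type := corestr (@acte M).
HB.instance Definition _ := GRing.Lmodule.on eM_type.
HB.instance Definition _ := GRing.Linear.on eM_proj.

Definition eM_coact (x : eM_type) : eM_type ⊗ eCe :=
  tmap eM_proj eCe_proj (coact M (\val x)).
HB.instance Definition _ := GRing.Linear.copy eM_coact
  (tmap eM_proj eCe_proj \o coact M \o incl (lin_img (@acte M))).

Lemma eM_coactE m : eM_coact (eM_proj m) = tmap eM_proj eCe_proj (coact M m).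
Proof.
rewrite /eM_coact /= coact_act tmap_comp.
apply: eq_tmap => // c; exact: eCe_proj_lact.
Qed.

Lemma eM_coactA x :
  tassoc (tmap eM_coact idfun (eM_coact x))
  = tmap idfun (comult eCe) (eM_coact x).
Proof.
have [m ->] := corestr_surj x; rewrite -/(eM_proj m) eM_coactE tmap_comp.
rewrite (@eq_tmap _ _ _ _ _ _ (tmap eM_proj eCe_proj \o coact M) _
  (eCe_proj \o idfun)) //; last exact: eM_coactE.
rewrite -tmap_comp tassoc_tmap coactA !tmap_comp; apply: eq_tmap => // c /=.
by rewrite eCe_comultE.
Qed.

Lemma eM_coact1 x : tcontrr (counit eCe) (eM_coact x) = x.
Proof.
have [m ->] := corestr_surj x; rewrite -/(eM_proj m) eM_coactE.
rewrite (@tcontrr_tmap _ _ _ _ _ _ _ _ e); last exact: eCe_counitE.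
by apply: val_inj; rewrite /= act_idem.
Qed.

Definition quotient_functor : comodule eCe := Comodule eM_coactA eM_coact1.
End QuotientFunctor.

Definition Ce_type := sub_of (lin_img racte).
Definition Ce_proj : C -> Ce_type := corestr racte.
HB.instance Definition _ := GRing.Lmodule.on Ce_type.
HB.instance Definition _ := GRing.Linear.on Ce_proj.

Lemma Ce_proj_ract c : Ce_proj (racte c) = Ce_proj c.
Proof. by apply: val_inj; rewrite /= ract_idem. Qed.

Definition Ce_coact (x : Ce_type) : Ce_type ⊗ C :=
  tmap Ce_proj idfun (comult C (\val x)).
HB.instance Definition _ := GRing.Linear.copy Ce_coact
  (tmap Ce_proj idfun \o comult C \o incl (lin_img racte)).
Definition Ce_lcoact (x : Ce_type) : eCe ⊗ Ce_type :=
  tmap eCe_proj Ce_proj (comult C (\val x)).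
HB.instance Definition _ := GRing.Linear.copy Ce_lcoact
  (tmap eCe_proj Ce_proj \o comult C \o incl (lin_img racte)).

Lemma Ce_coactE c : Ce_coact (Ce_proj c) = tmap Ce_proj idfun (comult C c).
Proof.
rewrite /Ce_coact /= comult_ract tmap_comp.
apply: eq_tmap => // d; exact: Ce_proj_ract.
Qed.

Lemma Ce_lcoactE c :
  Ce_lcoact (Ce_proj c) = tmap eCe_proj Ce_proj (comult C c).
Proof.
rewrite /Ce_lcoact /= comult_ract tmap_comp.
apply: eq_tmap => // d; exact: eCe_proj_ract.
Qed.

Lemma Ce_coactA x :
  tassoc (tmap Ce_coact idfun (Ce_coact x))
  = tmap idfun (comult C) (Ce_coact x).
Proof.
have [c ->] := corestr_surj x; rewrite -/(Ce_proj c) Ce_coactE tmap_comp.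
rewrite (@eq_tmap _ _ _ _ _ _ (tmap Ce_proj idfun \o comult C) _
  (idfun \o idfun)) //; last exact: Ce_coactE.
rewrite -tmap_comp tassoc_tmap comultA !tmap_comp; apply: eq_tmap => // d.
by rewrite /= tmap_id.
Qed.

Lemma Ce_coact1 x : tcontrr (counit C) (Ce_coact x) = x.
Proof.
have [c ->] := corestr_surj x; rewrite -/(Ce_proj c) Ce_coactE.
by rewrite (@tcontrr_tmap _ _ _ _ _ _ _ _ (counit C)) ?counitr.
Qed.

Lemma Ce_lcoactA x :
  tassoc (tmap (comult eCe) idfun (Ce_lcoact x))
  = tmap idfun Ce_lcoact (Ce_lcoact x).
Proof.
have [c ->] := corestr_surj x; rewrite -/(Ce_proj c) Ce_lcoactE tmap_comp.
rewrite (@eq_tmap _ _ _ _ _ _ (tmap eCe_proj eCe_proj \o comult C) _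
  (Ce_proj \o idfun)) //; last exact: eCe_comultE.
rewrite -tmap_comp tassoc_tmap comultA !tmap_comp; apply: eq_tmap => // d /=.
by rewrite Ce_lcoactE.
Qed.

Lemma Ce_lcoact1 x : tcontrl (counit eCe) (Ce_lcoact x) = x.
Proof.
have [c ->] := corestr_surj x; rewrite -/(Ce_proj c) Ce_lcoactE.
rewrite (@tcontrl_tmap _ _ _ _ _ _ _ _ e); last exact: eCe_counitE.
exact: Ce_proj_ract.
Qed.

Definition Ce_comod : comodule C := Comodule Ce_coactA Ce_coact1.

Lemma Ce_bicomodP x :
  tassoc (tmap Ce_lcoact idfun (coact Ce_comod x))
  = tmap idfun (coact Ce_comod) (Ce_lcoact x).
Proof.
have [c ->] := corestr_surj x; rewrite -/(Ce_proj c) /= Ce_lcoactE Ce_coactE.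
rewrite tmap_comp.
rewrite (@eq_tmap _ _ _ _ _ _ (tmap eCe_proj Ce_proj \o comult C) _
  (idfun \o idfun)) //; last exact: Ce_lcoactE.
rewrite -tmap_comp tassoc_tmap comultA !tmap_comp; apply: eq_tmap => // d /=.
by rewrite Ce_coactE.
Qed.

Definition Ce : bicomodule eCe C :=
  @Bicomodule _ eCe C Ce_comod Ce_lcoact Ce_lcoactA Ce_lcoact1 Ce_bicomodP.

Definition section_functor (N : comodule eCe) : comodule C := cotensor N Ce.

Definition torsion (M : comodule C) :=
  forall v : quotient_functor M, v = 0.
Definition torsion_free (M : comodule C) :=
  exists v : quotient_functor M, v != 0.

End Idempotent.

(* Main.v *)
(* The dual algebra C^* acts on every comodule, subcomodules and comodule maps *)
(* being the stable subspaces and equivariant maps. Put Q = S(S_x). There are *)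
(* an embedding of Q in E_x over S_x and an inclusion eQ <= S_x, and any m in *)
(* E_x with e(C^* m) <= S_x lies in Q. Hence Q/Soc^n Q is torsion for n >= 1, *)
(* which gives (a), and it embeds in E_x/Soc^n E_x, which gives (b). For (c), *)
(* a simple S_y in M/Soc M has a nonsplit extension by a simple subcomodule   *)
(* of M: take a finite-dimensional D in the preimage of S_y, minimal not in   *)
(* Soc M, and divide by a maximal proper subcomodule of its socle. Apply this *)
(* to M = Q/Soc^(n-1) Q and induct. For the converse, climb the path: if      *)
(* S_i <= Q/Soc^i Q, a nonsplit extension X of S_(i+1) by S_i embeds in the   *)
(* injective E_x/Soc^i Q, and lands in Q/Soc^i Q as S_(i+1) is torsion; the   *)
(* quotient X/S_i = S_(i+1) then embeds in Q/Soc^(i+1) Q.                     *)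
Require Import Defs.
From HB Require Import structures.
From mathcomp Require Import all_boot all_algebra.
From mathcomp Require Import boolp.

Set Implicit Arguments.
Unset Strict Implicit.
Unset Printing Implicit Defensive.

Import GRing.Theory.
Local Open Scope ring_scope.

(** Inside [E x], the comodule Q = S(S_x) is the largest subcomodule M with eM contained in S_x;
    equivalently, Q/S_x is the largest torsion subcomodule of E_x/S_x. This is
    [section_in_envelope_ex], and the rest of the argument uses only this description of Q. That
    Q/S_x is torsion gives (a) in [embed_loewy_torsion]. Compatibility of Loewy series with
    embeddings ([loewy_inj]) and [ext1_quot_socle] give (b). For (c), [ext1_simple_sub] produces one
    arrow of the path for each Loewy layer, and [embed_loewy_path] assembles them. Conversely,
    maximality of Q together with heredity lets [embed_loewyS] climb one layer for each arrow. *)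

(** * Linear functionals separate the elements of a tensor product *)

Section Separation.
Context (K : fieldType).

Lemma linear_ex (V W : lmodType K) (f : V -> W) :
  linear f -> exists g : {linear V -> W}, g =1 f.
Proof.
move=> flin.
by exists (HB.pack_for {linear V -> W} f (GRing.isLinear.Build K V W _ f flin)).
Qed.

Lemma scalar_ex (V : lmodType K) (f : V -> K) :
  scalar f -> exists g : {scalar V}, g =1 f.
Proof.
move=> flin.
by exists (HB.pack_for {scalar V} f (GRing.isLinear.Build K V K _ f flin)).
Qed.

Lemma subspace_ex (V : lmodType K) (P : V -> Prop) :
  P 0 -> (forall a u v, P u -> P v -> P (a *: u + v)) ->
  exists N : subspace V, forall v, v \in N <-> P v.
Proof.
move=> P0 PD.
have C : submod_closed [pred v | `[< P v >]].
  split=> [|a u v]; first exact/asboolP.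
  by move=> /asboolP Pu /asboolP Pv; apply/asboolP/PD.
by exists (Subspace C) => v; split=> /asboolP.
Qed.

(** A quasi-inverse g of the map sending a to a w satisfies g(w) w = w, so g is the functional. *)
Lemma scalar_form_ex (W : lmodType K) (w : W) : w != 0 ->
  exists phi : {scalar W}, phi w = 1.
Proof.
move=> w0; pose f0 (a : K^o) : W := (a : K) *: w.
have [|f fE] := @linear_ex K^o W f0.
  by move=> a b c; rewrite /f0 scalerDl scalerA.
have [g gP] := quasi_inverse_ex f.
have [|phi phiE] := @scalar_ex W (g : W -> K).
  by move=> a u v; rewrite linearP.
exists phi; rewrite phiE.
have := gP 1; rewrite !fE /f0 scale1r => /eqP; rewrite -subr_eq0.
rewrite -[X in _ - X]scale1r -scalerBl scaler_eq0 (negPf w0) orbF subr_eq0.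
by move/eqP.
Qed.

Lemma scalar_form_sep (W : lmodType K) (N : subspace W) (w : W) :
  w \notin N -> exists phi : {scalar W}, phi w = 1 /\ {in N, forall v, phi v = 0}.
Proof.
move=> wN; have [phi phiP] : exists phi : {scalar lquot N}, phi (lproj N w) = 1.
  apply: scalar_form_ex; apply: contraNneq wN.
  by move=> /(lproj_eq0 N w).1.
have [|psi psiE] := @scalar_ex W (phi \o @lproj _ _ N).
  by move=> a u v; rewrite /= !linearP.
exists psi; split=> [|v vN]; rewrite psiE //=.
by rewrite (lproj_eq0 _ _).2 // linear0.
Qed.

(* A linear relation between the second factors shortens the sum; without one *)
(* some functional isolates the first term.                                   *)
Lemma tens_sum_sep (V W : lmodType K) n (v : 'I_n -> V) (w : 'I_n -> W) :
  (forall phi : {scalar W}, \sum_i phi (w i) *: v i = 0) ->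
  \sum_i v i ⊗v w i = 0.
Proof.
elim: n v w => [|n IH] v w hs; first by rewrite big_ord0.
have [||N NP] := @subspace_ex W (fun u =>
    exists a : 'I_n -> K, u = \sum_i a i *: w (lift ord0 i)).
- by exists (fun=> 0); rewrite big1 // => i _; rewrite scale0r.
- move=> a _ _ [f ->] [g ->]; exists (fun i => a * f i + g i).
  rewrite scaler_sumr -big_split /=.
  by apply: eq_bigr => i _; rewrite scalerDl scalerA.
have [/NP[a wE]|wN] := boolP (w ord0 \in N).
  have -> : \sum_i v i ⊗v w i =
      \sum_i (v (lift ord0 i) + a i *: v ord0) ⊗v w (lift ord0 i).
    rewrite big_ord_recl wE linear_sum -big_split /=.
    by apply: eq_bigr => i _; rewrite linearDl addrC linearZr_LR linearZl_LR.
  apply: IH => phi; rewrite -[RHS](hs phi) big_ord_recl wE linear_sum.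
  rewrite scaler_suml -big_split; apply: eq_bigr => i _.
  by rewrite scalerDr addrC; congr (_ + _); rewrite scalerA linearZ mulrC.
have [phi [phiw phi0]] := scalar_form_sep wN.
have phi0' i : phi (w (lift ord0 i)) = 0.
  apply/phi0/NP; exists (fun k => (k == i)%:R).
  rewrite (bigD1 i) //= eqxx scale1r big1 ?addr0 // => k /negPf->.
  by rewrite scale0r.
have v0 : v ord0 = 0.
  have := hs phi; rewrite big_ord_recl phiw scale1r big1 ?addr0 // => i _.
  by rewrite phi0' scale0r.
rewrite big_ord_recl v0 linear0l add0r; apply: IH => psi.
by have := hs psi; rewrite big_ord_recl v0 scaler0 add0r.
Qed.

Lemma tensor_sum (V W : lmodType K) (x : V ⊗ W) :
  exists n (v : 'I_n -> V) (w : 'I_n -> W), x = \sum_i v i ⊗v w i.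
Proof.
rewrite {1}[x]tensorE; set s := repr x.
exists (size s), (fun i => (tnth (in_tuple s) i).1),
  (fun i => (tnth (in_tuple s) i).2).
by rewrite big_tnth.
Qed.

Lemma tcontrr_sum (V W : lmodType K) (phi : {scalar W}) n
    (v : 'I_n -> V) (w : 'I_n -> W) :
  tcontrr phi (\sum_i v i ⊗v w i) = \sum_i phi (w i) *: v i.
Proof. by rewrite linear_sum; apply: eq_bigr => i _; apply: tcontrrE. Qed.

(** This reduces identities between coactions to identities for the action of the dual algebra. *)
Lemma tcontrr_sep (V W : lmodType K) (x y : V ⊗ W) :
  (forall phi : {scalar W}, tcontrr phi x = tcontrr phi y) -> x = y.
Proof.
move=> h; apply/eqP; rewrite -subr_eq0; apply/eqP.
have {h} : forall phi : {scalar W}, tcontrr phi (x - y) = 0.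
  by move=> phi; rewrite linearB /= h subrr.
have [n [v [w ->]]] := tensor_sum (x - y) => h.
by apply: tens_sum_sep => phi; rewrite -tcontrr_sum.
Qed.

End Separation.

(** * Comodules as modules over the dual algebra *)

Section DualAction.
Context (K : fieldType) (C : coalgebra K).
Implicit Types (M N X A B : comodule C) (phi psi : {scalar C}).

(** For [phi = e] this is convertible to [acte], so the facts on [acte] apply to it. *)
Definition act phi M (m : M) : M := tcontrr phi (coact M m).
HB.instance Definition _ phi M := GRing.Linear.copy (@act phi M)
  (tcontrr phi \o coact M).

Lemma act_is_linear phi M a (m m' : M) :
  act phi (a *: m + m') = a *: act phi m + act phi m'.
Proof. exact: linearP. Qed.

Lemma act0 phi M : act phi (0 : M) = 0.
Proof. exact: linear0. Qed.

Lemma act_counit M (m : M) : act (counit C) m = m.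
Proof. exact: coact1. Qed.

Lemma coact_actE phi M (m : M) :
  coact M (act phi m) = tmap idfun (@act phi (regular_comod C)) (coact M m).
Proof.
rewrite /act -(@tcontrr_tmap _ _ _ _ _ (coact M) idfun phi) //.
rewrite tcontrr_assoc coactA tmap_comp; exact: eq_tmap.
Qed.

(** The form [chi] is the convolution product of [phi] and [psi]; it serves all comodules at
    once. *)
Lemma act_conv_ex phi psi : exists chi : {scalar C},
  forall M (m : M), act chi m = act phi (act psi m).
Proof.
have [|chi chiE] := @scalar_ex K C (conv phi psi).
  by move=> a u v; rewrite /conv !linearP.
exists chi => M m; rewrite {2}/act coact_actE.
rewrite (@tcontrr_tmap _ _ _ _ _ _ _ _ chi) // => c.
by rewrite chiE /conv tpair_contrr.
Qed.

Lemma act_lin_ex a phi psi : exists chi : {scalar C},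
  forall M (m : M), act chi m = a *: act phi m + act psi m.
Proof.
have [|chi chiE] := @scalar_ex K C (fun c => a * phi c + psi c).
  move=> b u v; rewrite !linearP /= mulrDr mulrDr addrACA.
  by congr (_ + _); rewrite mulrCA.
exists chi => M m; rewrite /act.
have [n [v [w ->]]] := tensor_sum (coact M m).
rewrite !tcontrr_sum scaler_sumr -big_split /=.
by apply: eq_bigr => i _; rewrite chiE scalerDl scalerA.
Qed.

Lemma act_hom M N (f : comod_hom M N) phi m : f (act phi m) = act phi (f m).
Proof.
rewrite /act comod_homP.
by rewrite (@tcontrr_tmap _ _ _ _ _ _ _ phi phi).
Qed.

(** Equivariance says that the two sides of the colinearity equation have the same contractions, and
    contractions separate. *)
Lemma hom_ex M N (f : {linear M -> N}) :
  (forall phi m, f (act phi m) = act phi (f m)) ->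
  exists g : comod_hom M N, forall m, g m = f m.
Proof.
move=> fact.
suff fP m : coact N (f m) = tmap f idfun (coact M m) by exists (ComodHom fP).
apply: tcontrr_sep => phi; rewrite -/(act phi _) -fact.
by rewrite (@tcontrr_tmap _ _ _ _ _ _ _ phi phi).
Qed.

(** By linearity a trivial fibre over 0 makes the relation single-valued. Comodule maps can thus be
    defined by inverting or lifting along others, without a formula. *)
Lemma hom_of_graph X B (R : X -> B -> Prop) :
  (forall x, exists b, R x b) -> (forall b, R 0 b -> b = 0) ->
  (forall a x b x' b', R x b -> R x' b' -> R (a *: x + x') (a *: b + b')) ->
  (forall phi x b, R x b -> R (act phi x) (act phi b)) ->
  exists u : comod_hom X B, forall x, R x (u x).
Proof.
move=> Rtot R0 Rlin Ract; have [u0 uR] := choice Rtot.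
have Runiq x b : R x b -> u0 x = b.
  move=> Rxb; have := Rlin (-1) _ _ _ _ (uR x) Rxb.
  rewrite !scaleN1r addNr => /R0/eqP.
  by rewrite addrC subr_eq0 => /eqP->.
have [|u uE] := @linear_ex K X B u0.
  by move=> a x x'; apply/Runiq/Rlin.
have [|g gE] := @hom_ex X B u.
  by move=> phi x; rewrite !uE; apply/Runiq/Ract.
by exists g => x; rewrite gE uE.
Qed.

Lemma comp_hom_ex M N X (f : comod_hom M N) (g : comod_hom N X) :
  exists h : comod_hom M X, forall m, h m = g (f m).
Proof.
by apply: (@hom_ex _ _ (g \o f)) => phi m; rewrite /= !act_hom.
Qed.

Lemma sub_hom_ex M N (f g : comod_hom M N) :
  exists h : comod_hom M N, forall m, h m = f m - g m.
Proof.
apply: (@hom_ex _ _ (f \- g)) => phi m.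
by rewrite /= !act_hom -[LHS](linearB (@act phi N)).
Qed.

Lemma factor_surj X A B (p : comod_hom X A) (t : comod_hom X B) :
  (forall a, exists x, p x = a) -> (forall x, p x = 0 -> t x = 0) ->
  exists u : comod_hom A B, forall x, u (p x) = t x.
Proof.
move=> psurj pt.
have [||||u uP] := @hom_of_graph A B (fun a b => exists2 x, p x = a & t x = b).
- by move=> a; have [x <-] := psurj a; exists (t x), x.
- by move=> b [x /pt-> ->].
- by move=> a _ _ _ _ [x <- <-] [x' <- <-]; exists (a *: x + x'); rewrite linearP.
- by move=> phi _ _ [x <- <-]; exists (act phi x); rewrite act_hom.
exists u => x; have [x' px' <-] := uP (p x).
apply/eqP; rewrite -subr_eq0 -linearB; apply/eqP/pt.
by rewrite linearB px' subrr.
Qed.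

Lemma factor_inj X A B (i : comod_hom A B) (t : comod_hom X B) :
  injective i -> (forall x, exists a, t x = i a) ->
  exists u : comod_hom X A, forall x, i (u x) = t x.
Proof.
move=> iinj it; apply: (@hom_of_graph X A (fun x a => i a = t x)).
- by move=> x; have [a ->] := it x; exists a.
- by move=> b; rewrite linear0 -[RHS](linear0 i) => /iinj.
- by move=> a x b x' b' hx hx'; rewrite !linearP hx hx'.
- by move=> phi x b hx; rewrite !act_hom hx.
Qed.

Lemma hom_injP M N (f : comod_hom M N) :
  (forall m, f m = 0 -> m = 0) <-> injective f.
Proof.
split=> [h m m' /eqP|finj m]; last by rewrite -[RHS](linear0 f) => /finj.
rewrite -subr_eq0 -linearB => /eqP/h/eqP.
by rewrite subr_eq0 => /eqP.
Qed.

Lemma act_subcomod M (N : subcomodule M) phi m : m \in N -> act phi m \in N.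
Proof.
move=> /subcomodP[s sN mE]; rewrite /act mE linear_sum /= big_seq.
by apply: rpred_sum => p ps; rewrite tcontrrE rpredZ // sN.
Qed.

(** Modulo the subspace, every functional kills the coaction of u, so that coaction vanishes there;
    exactness of the tensor product over a field then places it in the subspace tensored with C. *)
Lemma subcomod_ex M (P : M -> Prop) :
  P 0 -> (forall a u v, P u -> P v -> P (a *: u + v)) ->
  (forall phi u, P u -> P (act phi u)) ->
  exists N : subcomodule M, forall m, m \in N <-> P m.
Proof.
move=> P0 PD Pact; have [N NP] := subspace_ex P0 PD.
suff NC m : m \in N -> in_tensl N (coact M m) by exists (Subcomodule NC).
move=> mN; apply: (@in_tensl_mono _ _ _ (lin_ker (@lproj _ _ N))) => [v|].
  by rewrite inE => /eqP/lproj_eq0.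
apply: tmap_ker; apply: tcontrr_sep => phi.
rewrite (@tcontrr_tmap _ _ _ _ _ _ _ phi phi) // linear0.
by apply/lproj_eq0/NP/Pact/NP.
Qed.

Lemma hom_img_ex M N (f : comod_hom M N) :
  exists U : subcomodule N, forall v, v \in U <-> exists m, v = f m.
Proof.
apply: subcomod_ex.
- by exists 0; rewrite linear0.
- by move=> a _ _ [m ->] [m' ->]; exists (a *: m + m'); rewrite linearP.
- by move=> phi _ [m ->]; exists (act phi m); rewrite act_hom.
Qed.

Lemma sub_inclE M (N : subcomodule M) (x : N) : sub_incl N x = \val x.
Proof. by []. Qed.

Lemma quot_projE M (N : subcomodule M) (m : M) : quot_proj N m = 0 <-> m \in N.
Proof. exact: lproj_eq0. Qed.

Lemma quot_proj_surj M (N : subcomodule M) (x : quot_comod N) :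
  exists m, quot_proj N m = x.
Proof. by have [m ->] := lproj_surj x; exists m. Qed.

End DualAction.

(** * Simple comodules, socles and Loewy series *)

Section Socle.
Context (K : fieldType) (C : coalgebra K).
Implicit Types (M N X A B S : comodule C).

Lemma simple_hom_inj S M (f : comod_hom S M) s :
  simple_comod S -> f s != 0 -> injective f.
Proof.
move=> [_ Ssim] fs; apply/hom_injP => m fm.
have [h|h] := Ssim (hom_ker f); first by apply: h; rewrite inE fm.
by have := h s; rewrite inE (negPf fs).
Qed.

Lemma simple_iso S M (f : comod_hom S M) :
  simple_comod S -> injective f -> (forall m, exists s, m = f s) ->
  simple_comod M.
Proof.
move=> [[s s0] Ssim] finj fsurj; split.
  by exists (f s); rewrite -(linear0 f) (inj_eq finj).
move=> N; have [h|h] := Ssim (preim_subcomod f N).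
  left=> m; have [t ->] := fsurj m => ftN.
  by rewrite (h t) ?linear0.
by right=> m; have [t ->] := fsurj m; apply: (h t).
Qed.

Lemma simple_sub M (N U : subcomodule M) : simple_comod N ->
  (forall m, m \in N -> m \in U -> m = 0) \/ (forall m, m \in N -> m \in U).
Proof.
move=> [_ Nsim]; have [h|h] := Nsim (preim_subcomod (sub_incl N) U).
  by left=> m mN mU; have := h (SubOf mN) mU => /(congr1 val).
by right=> m mN; apply: (h (SubOf mN)).
Qed.

Lemma simple_img S M (f : comod_hom S M) :
  simple_comod S -> injective f ->
  exists2 U : subcomodule M, simple_comod U & forall v, v \in U <-> exists s, v = f s.
Proof.
move=> Ssim finj; have [U UP] := hom_img_ex f; exists U => //.
have [|s|u uE] := @factor_inj _ _ S U M (sub_incl U) f; first exact: val_inj.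
  have fsU : f s \in U by apply/UP; exists s.
  by exists (SubOf fsU).
apply: (simple_iso (f := u)) => //.
  by move=> s s' e; apply: finj; rewrite -!uE e.
move=> m; have [s mE] := (UP (\val m)).1 (valP m); exists s.
by apply: val_inj; rewrite mE -uE.
Qed.

Lemma mem_socle M (N : subcomodule M) m :
  simple_comod N -> m \in N -> m \in comod_socle M.
Proof.
move=> Nsim mN; apply/asboolP; exists [:: m]; rewrite ?big_seq1 // => u.
by rewrite inE => /eqP->; exists N.
Qed.

Lemma simple_img_socle S M (f : comod_hom S M) s :
  simple_comod S -> f s \in comod_socle M.
Proof.
move=> Ssim; have [->|fs] := eqVneq (f s) 0; first exact: rpred0.
have [U Usim UP] := simple_img Ssim (simple_hom_inj Ssim fs).
by apply: (mem_socle Usim); apply/UP; exists s.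
Qed.

Lemma socleP M m : m \in comod_socle M -> exists2 s : seq M,
  (forall u, u \in s -> exists2 N : subcomodule M, simple_comod N & u \in N) &
  m = \sum_(u <- s) u.
Proof. by move/asboolP. Qed.

Lemma socle_hom M N (f : comod_hom M N) m :
  m \in comod_socle M -> f m \in comod_socle N.
Proof.
move=> /socleP[s sS ->]; rewrite linear_sum big_seq; apply: rpred_sum => u us.
have [U Usim uU] := sS u us.
have [h hE] := comp_hom_ex (sub_incl U) f.
by have := @simple_img_socle _ _ h (SubOf uU) Usim; rewrite hE.
Qed.

(* Each simple either lies in [U + V] already or can be added to [V]. *)
Lemma socle_complement M (U : subcomodule M) (s : seq M) :
  (forall u, u \in s -> exists2 N : subcomodule M, simple_comod N & u \in N) ->
  exists2 V : subcomodule M, (forall m, m \in U -> m \in V -> m = 0) &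
    forall u, u \in s -> exists N : subcomodule M, [/\ simple_comod N, u \in N &
      forall m, m \in N -> exists a b, [/\ a \in U, b \in V & m = a + b]].
Proof.
elim: s => [|u s IH] sS.
  by exists (zero_subcomod M) => // m _; rewrite inE => /eqP.
have [|V UV Vs] := IH; first by move=> v vs; apply: sS; rewrite inE vs orbT.
have [N Nsim uN] := sS u (mem_head _ _).
have [|||W WP] := @subcomod_ex _ _ M (fun m =>
    exists a b, [/\ a \in U, b \in V & m = a + b]).
- by exists 0, 0; rewrite !rpred0 addr0.
- move=> a _ _ [x [y [xU yV ->]]] [x' [y' [xU' yV' ->]]].
  exists (a *: x + x'), (a *: y + y').
  by rewrite !rpredD ?rpredZ // scalerDr addrACA.
- move=> phi _ [x [y [xU yV ->]]]; exists (act phi x), (act phi y).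
  by rewrite !act_subcomod // linearD.
have [NW|NW] := simple_sub W Nsim; last first.
  exists V => // v; rewrite inE => /orP[/eqP->|/Vs//].
  by exists N; split=> // m /NW/WP.
have [|||V' V'P] := @subcomod_ex _ _ M (fun m =>
    exists a b, [/\ a \in N, b \in V & m = a + b]).
- by exists 0, 0; rewrite !rpred0 addr0.
- move=> a _ _ [x [y [xU yV ->]]] [x' [y' [xU' yV' ->]]].
  exists (a *: x + x'), (a *: y + y').
  by rewrite !rpredD ?rpredZ // scalerDr addrACA.
- move=> phi _ [x [y [xU yV ->]]]; exists (act phi x), (act phi y).
  by rewrite !act_subcomod // linearD.
exists V' => [m mU /V'P[a [b [aN bV mE]]]|v].
  have a0 : a = 0.
    apply: NW => //; apply/WP; exists m, (- b); rewrite rpredN; split=> //.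
    by rewrite mE addrK.
  by apply: UV => //; rewrite mE a0 add0r.
rewrite inE => /orP[/eqP->|/Vs[N' [N'sim vN' N'P]]].
  exists N; split=> // m mN; exists 0, m; rewrite rpred0 add0r; split=> //.
  by apply/V'P; exists m, 0; rewrite rpred0 addr0.
exists N'; split=> // m /N'P[a [b [aU bV ->]]]; exists a, b; split=> //.
by apply/V'P; exists 0, b; rewrite rpred0 add0r.
Qed.

(** Choose a complement V of the image of f as in [socle_complement]. Projecting each simple summand
    along V and pulling back by f gives elements of the socle of M; what is left of f m lies both in
    V and in the image, hence is 0. *)
Lemma socle_inj M N (f : comod_hom M N) m :
  injective f -> f m \in comod_socle N -> m \in comod_socle M.
Proof.
move=> finj /socleP[s sS fmE]; have [U UP] := hom_img_ex f.
have [V UV sUV] := socle_complement U sS.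
have main u : u \in s ->
    exists2 m', m' \in comod_socle M & exists2 v, v \in V & u = f m' + v.
  move=> us; have [N' [N'sim uN' N'P]] := sUV u us.
  (* The projection of U + V onto U, read in M through f and restricted to the simple comodule. *)
  have [||||g gP] := @hom_of_graph _ _ N' M (fun x m' =>
      exists2 v, v \in V & \val x = f m' + v).
  - move=> [x xN]; have [a [b [/UP[m' ->] bV xE]]] := N'P x xN.
    by exists m', b.
  - move=> b [v vV] /eqP; rewrite eq_sym addr_eq0 => /eqP fbE.
    apply: finj; rewrite linear0; apply: UV; first by apply/UP; exists b.
    by rewrite fbE rpredN.
  - move=> a x b x' b' [v vV xE] [v' vV' xE'].
    exists (a *: v + v'); first by rewrite rpredD ?rpredZ.
    rewrite -[LHS]/(sub_incl N' (a *: x + x')) !linearP /= xE xE'.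
    by rewrite scalerDr addrACA.
  - move=> phi x b [v vV xE]; exists (act phi v); first exact: act_subcomod.
    rewrite -[LHS]/(sub_incl N' (act phi x)) !act_hom sub_inclE xE.
    by rewrite linearD.
  exists (g (SubOf uN')); first exact: simple_img_socle.
  by have [v vV uE] := gP (SubOf uN'); exists v.
have [m' m'S [v vV fmE']] : exists2 m', m' \in comod_socle M &
    exists2 v, v \in V & f m = f m' + v.
  rewrite fmE; elim: (s) main => [|u t IH] main.
    by exists 0; rewrite ?rpred0 //; exists 0; rewrite ?rpred0 // big_nil linear0 addr0.
  have [a aS [v vV uE]] := main u (mem_head _ _).
  have [|a' aS' [v' vV' tE]] := IH.
    by move=> w wt; apply: main; rewrite inE wt orbT.
  exists (a + a'); first exact: rpredD.
  exists (v + v'); first exact: rpredD.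
  by rewrite big_cons {1}uE tE linearD addrACA.
suff -> : m = m' by [].
apply/eqP; rewrite -subr_eq0; apply/eqP/finj; rewrite linear0.
have E : f (m - m') = v by rewrite linearB fmE' addrAC subrr add0r.
apply: UV; last by rewrite E.
by apply/UP; exists (m - m').
Qed.

(** [loewy] treats the first layer apart; here the recursion also covers n = 0, because the quotient
    by the zero subcomodule is injective. *)
Lemma loewyS M n m :
  m \in loewy M n.+1 <-> quot_proj (loewy M n) m \in comod_socle (quot_comod (loewy M n)).
Proof.
case: n => [|n] //=; split; first exact: (socle_hom (quot_proj (zero_subcomod M))).
apply: (socle_inj (f := quot_proj (zero_subcomod M))); apply/hom_injP => x /quot_projE.
by rewrite inE => /eqP.
Qed.

Lemma loewy_mono M n m : m \in loewy M n -> m \in loewy M n.+1.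
Proof. by move=> /quot_projE h; apply/loewyS; rewrite h rpred0. Qed.

Lemma socle_loewy M n m : m \in comod_socle M -> m \in loewy M n.+1.
Proof. by move=> mS; elim: n => // n IH; apply: loewy_mono. Qed.

Lemma quot_hom_ex M N (f : comod_hom M N) (U : subcomodule M) (V : subcomodule N) :
  (forall m, m \in U -> f m \in V) ->
  exists g : comod_hom (quot_comod U) (quot_comod V),
    forall m, g (quot_proj U m) = quot_proj V (f m).
Proof.
move=> fUV; have [t tE] := comp_hom_ex f (quot_proj V).
have [||g gE] := @factor_surj _ _ _ _ _ (quot_proj U) t.
- exact: quot_proj_surj.
- by move=> m /quot_projE/fUV mV; rewrite tE; apply/quot_projE.
by exists g => m; rewrite gE tE.
Qed.

Lemma quot_inj_ex M N (f : comod_hom M N) (U : subcomodule M) (V : subcomodule N) :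
  (forall m, m \in U <-> f m \in V) ->
  exists2 g : comod_hom (quot_comod U) (quot_comod V), injective g &
    forall m, g (quot_proj U m) = quot_proj V (f m).
Proof.
move=> fUV; have [g gE] := quot_hom_ex (fun m => (fUV m).1); exists g => //.
apply/hom_injP => x; have [m <-] := quot_proj_surj x.
by rewrite gE => /quot_projE/fUV/quot_projE.
Qed.

(** By induction f induces an embedding of M/Soc^n M in N/Soc^n N, to which [socle_inj] applies. *)
Lemma loewy_inj M N (f : comod_hom M N) n m :
  injective f -> m \in loewy M n <-> f m \in loewy N n.
Proof.
move=> finj; elim: n m => [|n IH] m.
  rewrite !inE; split=> [/eqP->|/eqP fm]; first by rewrite linear0.
  by apply/eqP/finj; rewrite fm linear0.
have [g ginj gE] := quot_inj_ex IH.
split=> /loewyS h; apply/loewyS; first by rewrite -gE; apply: socle_hom.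
by apply: (socle_inj ginj); rewrite gE.
Qed.

Lemma loewy_quot_ex M n :
  exists2 g : comod_hom (quot_comod (loewy M n.+1))
                        (quot_comod (comod_socle (quot_comod (loewy M n)))),
    injective g & forall m, g (quot_proj _ m) = quot_proj _ (quot_proj (loewy M n) m).
Proof. exact/quot_inj_ex/loewyS. Qed.

End Socle.

(** * Finite-dimensional subcomodules and chain conditions *)

Section FiniteDimension.
Context (K : fieldType) (C : coalgebra K) (M : comodule C).
Implicit Types (D U V : subcomodule M).

(** The spanning vectors need not lie in [D], so the property passes to smaller subcomodules at
    once. *)
Definition subcomod_fd D := exists n (v : 'I_n -> M),
  forall m, m \in D -> exists a : 'rV[K]_n, m = \sum_i a 0 i *: v i.

(** The subcomodule is the orbit of m under the dual algebra, which the finitely many left factors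
    of the coaction of m span. *)
Lemma cyclic_subcomod_ex (m : M) : exists D,
  [/\ subcomod_fd D, m \in D & forall U, m \in U -> {subset D <= U}].
Proof.
have [|||D DP] := @subcomod_ex _ _ M (fun x => exists phi, x = act phi m).
- have [chi chiE] := act_lin_ex (-1) (counit C) (counit C).
  by exists chi; rewrite chiE scaleN1r addNr.
- move=> a _ _ [phi ->] [psi ->]; have [chi chiE] := act_lin_ex a phi psi.
  by exists chi.
- move=> phi _ [psi ->]; have [chi chiE] := act_conv_ex phi psi.
  by exists chi.
exists D; split.
- have [n [v [w mE]]] := tensor_sum (coact M m).
  exists n, v => x /DP[phi ->]; exists (\row_i phi (w i)).
  by rewrite /act mE tcontrr_sum; apply: eq_bigr => i _; rewrite mxE.
- by apply/DP; exists (counit C); rewrite act_counit.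
- by move=> U mU x /DP[phi ->]; apply: act_subcomod.
Qed.

(* The rank of a largest matrix whose row space is sent into [U] by the       *)
(* coordinates of [D] is a strictly monotone measure of [U].                  *)
Lemma subcomod_rank_ex D : subcomod_fd D ->
  exists (rk : subcomodule M -> nat) (n : nat), (forall U, (rk U <= n)%N) /\
    forall U V, {subset U <= V} -> {subset V <= D} ->
      ~ {subset V <= U} -> (rk U < rk V)%N.
Proof.
move=> [n [v vP]]; pose L (a : 'rV[K]_n) := \sum_i a 0 i *: v i.
have LD c a b : L (c *: a + b) = c *: L a + L b.
  rewrite /L scaler_sumr -big_split; apply: eq_bigr => i _.
  by rewrite !mxE scalerDl scalerA.
pose good U (A : 'M[K]_n) := forall a : 'rV[K]_n, (a <= A)%MS -> L a \in U.
have goodmax U : exists A, good U A /\ forall B, good U B -> (\rank B <= \rank A)%N.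
  have ex0 : exists r, `[< exists2 A, good U A & \rank A = r >].
    exists 0%N; apply/asboolP; exists 0; last exact: mxrank0.
    by move=> a /submx0null->; rewrite /L big1 ?rpred0 // => i _; rewrite mxE scale0r.
  have bnd r : `[< exists2 A, good U A & \rank A = r >] -> (r <= n)%N.
    by move=> /asboolP[A _ <-]; apply: rank_leq_row.
  case: (ex_maxnP ex0 bnd) => r /asboolP[A gA <-] rmax; exists A; split=> // B gB.
  by apply: rmax; apply/asboolP; exists B.
have [A AP] := choice goodmax.
exists (fun U => \rank (A U)), n; split=> [U|U V UV VD]; first exact: rank_leq_row.
move=> /existsNP[x /not_implyP[xV xU]].
have [a xE] := vP x (VD x xV); have [gA Amax] := AP U.
have aA : ~~ (a <= A U)%MS by apply/negP => /gA; rewrite /L -xE.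
(* Adjoining the coordinates of an x in V outside U raises the rank, and the larger row space is
   still sent into V. *)
apply: leq_trans (_ : \rank (A U + a)%MS <= _)%N.
  rewrite rank_ltmx // /ltmx addsmxSl /=; apply: contra aA.
  exact: submx_trans (addsmxSr _ _).
apply: (AP V).2 => b /sub_addsmxP[[c d] ->] /=.
have -> : c *m A U + d *m a = d 0 0 *: a + c *m A U.
  by rewrite addrC [d in d *m a]mx11_scalar mul_scalar_mx.
rewrite LD; apply: rpredD; first by rewrite rpredZ // /L -xE.
by apply: UV; apply: gA; apply: submxMl.
Qed.

Lemma subcomod_min (P : subcomodule M -> Prop) D : subcomod_fd D -> P D ->
  exists2 U, P U /\ {subset U <= D} &
    forall V, {subset V <= U} -> P V -> {subset U <= V}.
Proof.
move=> fd; have [rk [_ [_ rkP]]] := subcomod_rank_ex fd.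
move=> PD; have DD : {subset D <= D} by [].
have [k] := ubnP (rk D); elim: k {1 2 4}D PD DD => // k IH U PU UD.
rewrite ltnS => Uk.
have [h|/existsNP[V /not_implyP[VU /not_implyP[PV UV]]]] :=
    pselect (forall V, {subset V <= U} -> P V -> {subset U <= V}).
  by exists U.
apply: (IH V) => //; first by move=> m /VU/UD.
exact: leq_trans (rkP _ _ VU UD UV) Uk.
Qed.

Lemma subcomod_max (P : subcomodule M -> Prop) D U :
  subcomod_fd D -> P U -> {subset U <= D} ->
  exists2 U, P U /\ {subset U <= D} &
    forall V, {subset U <= V} -> {subset V <= D} -> P V -> {subset V <= U}.
Proof.
move=> fd; have [rk [n [rkn rkP]]] := subcomod_rank_ex fd.
have [k Uk PU UD] := ubnP (n - rk U).
elim: k U Uk PU UD => // k IH U; rewrite ltnS => Uk PU UD.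
have [h|/existsNP[V /not_implyP[UV /not_implyP[VD /not_implyP[PV VU]]]]] :=
    pselect (forall V, {subset U <= V} -> {subset V <= D} -> P V -> {subset V <= U}).
  by exists U.
apply: (IH V) => //; apply: leq_trans Uk; apply: ltn_sub2l; last exact: rkP.
by apply: leq_trans (rkP _ _ UV VD VU) (rkn V).
Qed.

End FiniteDimension.

(** * Nonsplit extensions of simple comodules *)

Section Extensions.
Context (K : fieldType) (C : coalgebra K).
Implicit Types (M N X A B T : comodule C).

(** Since A is simple, p maps N isomorphically onto A; f is the inverse. *)
Lemma simple_section X A (p : comod_hom X A) (N : subcomodule X) k :
  simple_comod A -> (forall m, m \in N -> p m = 0 -> m = 0) ->
  k \in N -> p k != 0 ->
  exists f : comod_hom A X, forall a, f a \in N /\ p (f a) = a.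
Proof.
move=> [_ Asim] pN kN pk.
have [|||U UP] := @subcomod_ex _ _ A (fun a => exists2 m, m \in N & p m = a).
- by exists 0; rewrite ?rpred0 ?linear0.
- move=> a _ _ [m mN <-] [m' mN' <-]; exists (a *: m + m'); last by rewrite linearP.
  by rewrite rpredD ?rpredZ.
- by move=> phi _ [m mN <-]; exists (act phi m); rewrite ?act_hom ?act_subcomod.
have [U0|UT] := Asim U.
  by move: pk; rewrite (U0 (p k)) ?eqxx //; apply/UP; exists k.
apply: (@hom_of_graph _ _ A X (fun a x => x \in N /\ p x = a)).
- by move=> a; have /UP[m mN <-] := UT a; exists m.
- by move=> m [mN pm]; apply: pN.
- move=> a _ m _ m' [mN <-] [mN' <-]; split; last by rewrite linearP.
  by rewrite rpredD ?rpredZ.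
- by move=> phi _ m [mN <-]; split; rewrite ?act_hom ?act_subcomod.
Qed.

(** The kernel of f meets B trivially; were it nonzero, it would map isomorphically onto A and split
    the extension. *)
Lemma nonsplit_hom_inj A B (X : extension A B) M (f : comod_hom (ext_mid X) M) :
  simple_comod A -> ~ ext_split X -> (forall b, f (ext_inj X b) = 0 -> b = 0) ->
  injective f.
Proof.
move=> Asim Xns fB; apply/hom_injP => x fx.
apply: contrapT => /eqP x0; apply: Xns.
have kP m : m \in hom_ker f -> ext_proj X m = 0 -> m = 0.
  by rewrite inE => /eqP fm /ext_exact[b mE]; rewrite mE (fB b) ?linear0 -?mE.
have xk : x \in hom_ker f by rewrite inE fx.
have [|s sP] := simple_section Asim kP xk.
  by apply/eqP => /(kP _ xk)/eqP; rewrite (negPf x0).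
by exists s => a; have [] := sP a.
Qed.

(** A simple subcomodule not contained in B would map isomorphically onto A and split the
    extension. *)
Lemma nonsplit_socle A B (X : extension A B) x :
  simple_comod A -> ~ ext_split X -> x \in comod_socle (ext_mid X) ->
  ext_proj X x = 0.
Proof.
move=> Asim Xns /socleP[s sS ->]; rewrite linear_sum big_seq big1 // => u us.
have [N Nsim uN] := sS u us; apply: contrapT => /eqP pu; apply: Xns.
have [NK|NK] := simple_sub (hom_ker (ext_proj X)) Nsim; last first.
  by move: (NK u uN); rewrite inE (negPf pu).
have [|s' s'P] := simple_section Asim _ uN pu.
  by move=> m mN pm; apply: NK; rewrite ?inE ?pm.
by exists s' => a; have [] := s'P a.
Qed.

(** The extension is the preimage of A in M. A section would put a copy of A in the socle of M,
    hence in N, where the projection to A vanishes. *)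
Lemma ext1_quot_socle A M (N : subcomodule M) (s : comod_hom A (quot_comod N)) :
  simple_comod A -> {subset comod_socle M <= N} -> injective s ->
  Ext1_neq0 A N.
Proof.
move=> Asim socN sinj; have [U UP] := hom_img_ex s.
pose P := preim_subcomod (quot_proj N) U.
have PP m : m \in P <-> exists a, quot_proj N m = s a by apply: UP.
have [pN pNE] := comp_hom_ex (sub_incl P) (quot_proj N).
have [|pr prE] := factor_inj (t := pN) sinj.
  by move=> m; have /PP[a mE] := valP m; exists a; rewrite pNE.
have [||i iE] := @factor_inj _ _ N P M (sub_incl P) (sub_incl N).
- exact: val_inj.
- move=> m; have mP : \val m \in P.
    by apply/PP; exists 0; rewrite linear0; apply/quot_projE/valP.
  by exists (SubOf mP).
have pr0 x : pr x = 0 <-> \val x \in N.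
  rewrite -(quot_projE N); have := prE x; rewrite pNE sub_inclE => <-.
  by split=> [->|]; [rewrite linear0|rewrite -[RHS](linear0 s) => /sinj].
have iinj : injective i.
  by move=> a b ab; apply: val_inj; have := iE a; rewrite ab iE.
have prsurj a : exists x, pr x = a.
  have [m mE] := quot_proj_surj (s a).
  have mP : m \in P by apply/PP; exists a.
  by exists (SubOf mP); apply: sinj; rewrite prE pNE.
have exact x : pr x = 0 <-> exists b, x = i b.
  split=> [/pr0 xN|[b ->]]; last by apply/pr0; have := iE b => /= ->; apply: valP.
  by exists (SubOf xN); apply: val_inj; have := iE (SubOf xN) => /= ->.
exists (Extension iinj prsurj exact) => -[/= sec secE].
have [[a a0] _] := Asim; move/eqP: a0; apply.
rewrite -(secE a); apply/pr0/socN.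
have [h hE] := comp_hom_ex sec (sub_incl P).
by have := simple_img_socle h a Asim; rewrite hE.
Qed.

(** Take D minimal among the subcomodules of the preimage of A, inside a finite-dimensional one,
    that are not contained in the socle. Put R = D ∩ Soc M, and let R' be maximal among its proper
    subcomodules. Then D/R' is an extension of A by T = R/R', and a splitting would contradict the
    minimality of D. *)
Lemma ext1_simple_sub A M (s : comod_hom A (quot_comod (comod_socle M))) :
  simple_comod A -> injective s ->
  exists2 T : subcomodule M, simple_comod T & Ext1_neq0 A T.
Proof.
move=> Asim sinj; have [[a0 a0N] _] := Asim.
have [U UP] := hom_img_ex s.
pose P := preim_subcomod (quot_proj (comod_socle M)) U.
have PP m : m \in P <-> exists a, quot_proj (comod_socle M) m = s a by apply: UP.
have [m0 m0E] := quot_proj_surj (s a0).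
have [D0 [D0fd m0D0 D0min]] := cyclic_subcomod_ex m0.
pose notsoc (D : subcomodule M) :=
  {subset D <= P} /\ exists2 m, m \in D & m \notin comod_socle M.
have [|D [[DP [d dD dS]] DD0] Dmin] := @subcomod_min _ _ M notsoc D0 D0fd.
  split; first by apply: D0min; apply/PP; exists a0.
  exists m0 => //; apply/negP => /quot_projE; rewrite m0E -[RHS](linear0 s).
  by move/sinj/eqP; rewrite (negPf a0N).
have Dfd : subcomod_fd D.
  by have [n [v vP]] := D0fd; exists n, v => m /DD0/vP.
have [pN pNE] := comp_hom_ex (sub_incl D) (quot_proj (comod_socle M)).
have [|pr prE] := factor_inj (t := pN) sinj.
  by move=> m; have /DP/PP[a mE] := valP m; exists a; rewrite pNE.
have pr0 x : pr x = 0 <-> \val x \in comod_socle M.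
  rewrite -(quot_projE (comod_socle M)); have := prE x; rewrite pNE sub_inclE => <-.
  by split=> [->|]; [rewrite linear0|rewrite -[RHS](linear0 s) => /sinj].
pose d' : D := SubOf dD.
have prd : pr d' != 0 by apply/eqP => /pr0; apply/negP.
have prsurj a : exists x, pr x = a.
  have [V VP] := hom_img_ex pr; have [h|h] := Asim.2 V.
    by move/eqP: prd; case; apply: h; apply/VP; exists d'.
  by have /VP[x ->] := h a; exists x.
have [|||R RP] := @subcomod_ex _ _ M (fun m => m \in D /\ m \in comod_socle M).
- by rewrite !rpred0.
- by move=> a u v [uD uS] [vD vS]; rewrite !rpredD ?rpredZ.
- by move=> phi u [uD uS]; rewrite !act_subcomod.
pose proper (V : subcomodule M) := {subset V <= R} /\ ~ {subset R <= V}.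
have [||R' [[R'R RR'] _] R'max] := @subcomod_max _ _ M proper D (zero_subcomod M) Dfd.
- split=> [m|R0]; first by rewrite inE => /eqP->; apply: rpred0.
  (* If R were 0, D would be isomorphic to A, hence inside the socle. *)
  have inj x : x \in preim_subcomod (sub_incl D) D -> pr x = 0 -> x = 0.
    move=> _ /pr0 xS; have /R0 : \val x \in R by apply/RP; split=> //; apply: valP.
    by rewrite inE => /eqP x0; apply: val_inj.
  have [f fP] := simple_section (k := d') Asim inj dD prd.
  have dE : d' = f (pr d').
    apply/eqP; rewrite -subr_eq0; apply/eqP/inj; last first.
      by rewrite linearB (fP _).2 subrr.
    exact: valP.
  have [h hE] := comp_hom_ex f (sub_incl D).
  have := simple_img_socle h (pr d') Asim.
  by rewrite hE -dE /= (negPf dS).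
- by move=> m; rewrite inE => /eqP->; apply: rpred0.
have [T [Tsim TR TR']] : exists T : subcomodule M, [/\ simple_comod T,
    {subset T <= R} & exists2 t, t \in T & t \notin R'].
  move/existsNP: RR' => [r /not_implyP[rR rR']].
  pose r' : R := SubOf rR; have : r' \in comod_socle R.
    by apply: (socle_inj (f := sub_incl R)); [exact: val_inj|apply: ((RP r).1 rR).2].
  move=> /socleP[l lS rE].
  have [u ul uR'] : exists2 u, u \in l & \val u \notin R'.
    apply: contrapT => h; apply: rR'.
    have -> : r = sub_incl R r' by [].
    rewrite rE linear_sum big_seq; apply: rpred_sum => u ul.
    by apply: contrapT => /negP uR'; apply: h; exists u.
  have [N Nsim uN] := lS u ul.
  have [h hE] := comp_hom_ex (sub_incl N) (sub_incl R).
  have [|T Tsim TP] := simple_img (f := h) Nsim.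
    by move=> x y; rewrite !hE /= => /val_inj/val_inj.
  exists T; split=> //; first by move=> _ /TP[x ->]; rewrite hE; apply: valP.
  by exists (\val u) => //; apply/TP; exists (SubOf uN); rewrite hE.
have TR'0 t : t \in T -> t \in R' -> t = 0.
  have [h|h] := simple_sub R' Tsim; first exact: h.
  by have [t' /h->] := TR'.
(* R' + T is strictly larger than R', so by maximality it is all of R. *)
have RE r : r \in R -> exists a b, [/\ a \in R', b \in T & r = a + b].
  have [|||W WP] := @subcomod_ex _ _ M (fun m =>
      exists a b, [/\ a \in R', b \in T & m = a + b]).
  - by exists 0, 0; rewrite !rpred0 addr0.
  - move=> a _ _ [x [y [xU yV ->]]] [x' [y' [xU' yV' ->]]].
    exists (a *: x + x'), (a *: y + y').
    by rewrite !rpredD ?rpredZ // scalerDr addrACA.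
  - move=> phi _ [x [y [xU yV ->]]]; exists (act phi x), (act phi y).
    by rewrite !act_subcomod // linearD.
  move=> rR; apply/WP; apply: contrapT => rW.
  have WR : {subset W <= R}.
    by move=> _ /WP[a [b [/R'R aR /TR bR ->]]]; rewrite rpredD.
  have [t tT] := TR'; apply/negP; rewrite negbK; apply: (R'max W) => //.
  - by move=> a aR'; apply/WP; exists a, 0; rewrite rpred0 addr0.
  - by move=> w /WR/RP[].
  - by split=> // h; apply/rW/h.
  - by apply/WP; exists 0, t; rewrite rpred0 add0r.
exists T => //.
pose R'D := preim_subcomod (sub_incl D) R'.
have prR' x : quot_proj R'D x = 0 -> pr x = 0.
  by move=> /quot_projE xR'; apply/pr0; have /R'R/RP[] : \val x \in R' := xR'.
have [q qE] := factor_surj (@quot_proj_surj _ _ _ R'D) prR'.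
have [||iD iDE] := @factor_inj _ _ T D M (sub_incl D) (sub_incl T).
- exact: val_inj.
- move=> t; have tD : \val t \in D by have /TR/RP[] := valP t.
  by exists (SubOf tD).
have [i iE] := comp_hom_ex iD (quot_proj R'D).
have i0 t : i t = 0 -> t = 0.
  rewrite iE => /quot_projE tR'; apply: val_inj.
  have : sub_incl D (iD t) \in R' := tR'.
  by rewrite iDE /=; apply: TR'0; apply: valP.
have qi t : q (i t) = 0.
  rewrite iE qE; apply/pr0; rewrite -sub_inclE iDE.
  by have /TR/RP[] := valP t.
have exact x : q x = 0 <-> exists t, x = i t.
  split=> [|[t ->]//]; have [z <-] := quot_proj_surj x.
  rewrite qE => /pr0 zS.
  have /RE[a [b [aR' bT zE]]] : \val z \in R by apply/RP; split=> //; apply: valP.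
  exists (SubOf bT : T); rewrite iE; apply/eqP; rewrite -subr_eq0 -linearB.
  apply/eqP/quot_projE; rewrite inE linearB iDE /= zE addrK //.
have qsurj a : exists x, q x = a.
  by have [z <-] := prsurj a; exists (quot_proj R'D z).
exists (Extension ((hom_injP i).1 i0) qsurj exact) => -[/= sec secE].
(* The preimage in D of the section is not contained in the socle, so by minimality it is D and
   contains T; but it meets R only in R'. *)
have [|||D' D'P] := @subcomod_ex _ _ M (fun m => exists2 z : D, m = \val z &
    exists a, quot_proj R'D z = sec a).
- by exists 0 => //; exists 0; rewrite !linear0.
- move=> a _ _ [z -> [b zE]] [z' -> [b' zE']]; exists (a *: z + z') => //.
  by exists (a *: b + b'); rewrite !linearP zE zE'.
- move=> phi _ [z -> [b zE]]; exists (act phi z).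
    by rewrite -!sub_inclE act_hom.
  by exists (act phi b); rewrite !act_hom zE.
have /Dmin D'D : {subset D' <= D} by move=> _ /D'P[z -> _]; apply: valP.
have [t tT tR'] := TR'.
have /D'D/D'P[|z tE [a zE]] : t \in D by have /TR/RP[] := tT.
  split; first by move=> _ /D'P[z -> _]; apply: DP; apply: valP.
  have [z zE] := quot_proj_surj (sec a0).
  exists (\val z); first by apply/D'P; exists z => //; exists a0.
  by apply/negP => /pr0; rewrite -qE zE secE => /eqP; rewrite (negPf a0N).
have a00 : a = 0.
  by rewrite -(secE a) -zE qE; apply/pr0; rewrite -tE; have /TR/RP[] := tT.
move: zE; rewrite a00 linear0 => /quot_projE zR'.
by move/negP: tR'; apply; rewrite tE.
Qed.

End Extensions.

(** * The section functor and the unit of the adjunction *)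

Section SectionFunctor.
Context (K : fieldType) (C : coalgebra K) (e : idempotent_form C).
Implicit Types (M S E : comodule C) (N : comodule (eCe e)) (phi : {scalar C}).

Lemma act_tens (V : lmodType K) M phi (x : tens_comod V M) :
  act phi x = tmap idfun (@act _ _ phi M) x.
Proof.
rewrite /act /=; move: x; apply: (@tens_ext _ _ _ _
  (tcontrr phi \o @tens_coact _ _ V M) (tmap idfun (@act _ _ phi M))) => v m.
rewrite /= tmapE tens_coactE.
by rewrite (@tcontrr_tmap _ _ _ _ _ _ _ phi phi).
Qed.

Lemma val_act_section N phi (q : section_functor N) :
  \val (act phi q) = tmap idfun (@act _ _ phi (Ce e)) (\val q).
Proof.
rewrite -act_tens.
exact: (act_hom (sub_incl (hom_ker (cotensor_hom N (Ce e)))) phi q).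
Qed.

Lemma act_Ce_proj phi (c : C) :
  act phi (Ce_proj e c : Ce_comod e) = Ce_proj e (act phi (c : regular_comod C)).
Proof. by rewrite /act /= Ce_coactE (@tcontrr_tmap _ _ _ _ _ _ _ phi phi). Qed.

Lemma Ce_proj_surj (p : Ce_comod e) : exists c, p = Ce_proj e c.
Proof. exact: corestr_surj. Qed.

Lemma torsionP M : torsion e M <-> forall m : M, act e m = 0.
Proof.
split=> [h m|h v]; first by have := congr1 val (h (eM_proj e m)).
by have [m ->] := corestr_surj v; apply: val_inj; apply: h.
Qed.

Lemma torsion_freeP M : torsion_free e M <-> exists m : M, act e m != 0.
Proof.
split=> [[v]|[m em]]; last by exists (eM_proj e m).
by have [m ->] := corestr_surj v; exists m.
Qed.

Lemma act_e_idem M (m : M) : act e (act e m) = act e m.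
Proof. exact: act_idem. Qed.

Lemma eM_proj_act M (m : M) : eM_proj e (act e m) = eM_proj e m.
Proof. by apply: val_inj; apply: act_idem. Qed.

(* One half of the adjunction between the quotient and section functors. *)
Lemma section_hom_ex M N (k : {linear M -> N}) :
  (forall m, coact N (k m) = tmap k (eCe_proj e) (coact M m)) ->
  exists f : comod_hom M (section_functor N),
    forall m, \val (f m) = tmap k (Ce_proj e) (coact M m).
Proof.
move=> kP; pose f0 m := tmap k (Ce_proj e) (coact M m).
have f0P m : f0 m \in hom_ker (cotensor_hom N (Ce e)).
  rewrite inE /= subr_eq0; apply/eqP.
  have -> : tmap (coact N) idfun (f0 m)
      = tmap (tmap k (eCe_proj e)) (Ce_proj e) (tmap (coact M) idfun (coact M m)).
    by rewrite /f0 !tmap_comp; apply: eq_tmap.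
  rewrite tassoc_tmap coactA /f0 !tmap_comp; apply: eq_tmap => // c.
  exact/esym/Ce_lcoactE.
pose f1 m : section_functor N := SubOf (f0P m).
have [|f fE] := @linear_ex _ _ (section_functor N) f1.
  by move=> a u v; apply: val_inj; rewrite /= /f0 !linearP.
have [|g gE] := @hom_ex _ _ _ _ f; last by exists g => m; rewrite gE fE.
move=> phi m; rewrite !fE; apply: val_inj.
rewrite val_act_section /= /f0 coact_actE !tmap_comp; apply: eq_tmap => // c /=.
by rewrite act_Ce_proj.
Qed.

(** Contracting an element of the cotensor product with [eps], the counit restricted to Ce,
    evaluates it in N. *)
Lemma Ce_counit_ex : exists eps : {scalar Ce_type e},
  forall c, eps (Ce_proj e c) = e c.
Proof.
have [|eps epsE] := @scalar_ex _ (Ce_type e) (fun p => counit C (\val p)).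
  by move=> a u v; rewrite -[\val _]/(incl _ (a *: u + v)) !linearP.
exists eps => c; rewrite epsE /= /racte -tpair_contrl.
by rewrite tpair_contrr counitr.
Qed.

(** Every functional psi on Ce is [eps] composed with the action of e phi, where phi(c) = psi(ce).
    So the hypothesis kills all contractions of q. *)
Lemma section_torsion_free N (q : section_functor N) :
  (forall phi, act e (act phi q) = 0) -> q = 0.
Proof.
move=> eq0; have [eps epsE] := Ce_counit_ex; apply: val_inj.
apply: (@tcontrr_sep _ _ _ (\val q) 0) => psi; rewrite linear0.
have [|phi phiE] := @scalar_ex _ C (fun c => psi (Ce_proj e c)).
  by move=> a u v; rewrite !linearP.
have /(congr1 (fun z : section_functor N => tcontrr eps (\val z))) := eq0 phi.
rewrite linear0 !val_act_section tmap_comp.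
rewrite (@tcontrr_tmap _ _ _ _ _ _ _ eps psi) // => p /=.
have [c ->] := Ce_proj_surj p; rewrite !act_Ce_proj epsE.
rewrite -[act e _]/(acte e (_ : regular_comod C)) e_lact /act -tpair_contrr.
by rewrite tpair_contrl phiE -/(racte e c) Ce_proj_ract.
Qed.

(** The second assertion says that eQ comes from eS: contracting the cotensor equation of q with
    [eps] expresses eq through the value of q in eS. *)
Lemma section_unit_ex S :
  exists2 eta : comod_hom S (section_functor (quotient_functor e S)),
  (forall s, \val (eta s) = tmap (@eM_proj _ _ e S) (Ce_proj e) (coact S s)) &
  forall q, exists s, act e q = eta (act e s).
Proof.
have [|eta etaE] := @section_hom_ex S (quotient_functor e S) (@eM_proj _ _ e S).
  by move=> m; apply: eM_coactE.
exists eta => // q; have [eps epsE] := Ce_counit_ex.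
have [s sE] : exists s, tcontrr eps (\val q) = eM_proj e s by apply: corestr_surj.
have coE : coact (quotient_functor e S) (eM_proj e s)
    = tmap (@eM_proj _ _ e S) (eCe_proj e) (coact S s) := eM_coactE e s.
exists s; apply: val_inj; rewrite etaE.
rewrite val_act_section.
(* The inclusion of eCe in Ce. *)
pose J : {linear eCe_type e -> Ce_type e} := Ce_proj e \o incl (lin_img (biact e)).
have JE c : J (eCe_proj e c) = Ce_proj e (act e (c : regular_comod C)).
  by rewrite /= /biact lact_ract Ce_proj_ract.
have cotE : tassoc (tmap (coact (quotient_functor e S)) idfun (\val q))
    = tmap idfun (lcoact (Ce e)) (\val q).
  by apply/eqP; rewrite -subr_eq0; have := valP q; rewrite inE.
have /(congr1 (tmap idfun J)) :
    tcontrr eps (tmap (coact (quotient_functor e S)) idfun (\val q))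
    = tmap idfun (tcontrr eps \o lcoact (Ce e)) (\val q).
  rewrite tcontrr_assoc cotE tmap_comp; exact: eq_tmap.
rewrite (@tcontrr_tmap _ _ _ _ _ _ _ eps eps) // sE.
rewrite coE !tmap_comp => h.
transitivity (tmap (idfun \o idfun) (J \o (tcontrr eps \o lcoact (Ce e))) (\val q)).
  apply: eq_tmap => // p; have [c ->] := Ce_proj_surj p.
  transitivity (Ce_proj e (act e (c : regular_comod C))); first exact: act_Ce_proj.
  rewrite -JE -(eCe_proj_lact e c); congr (J _).
  by rewrite /= Ce_lcoactE (@tcontrr_tmap _ _ _ _ _ _ _ eps e).
by rewrite -h coact_actE tmap_comp; apply: eq_tmap.
Qed.

End SectionFunctor.

(** * The comodule S(S_x) inside the injective envelope *)

Section Envelope.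
Context (K : fieldType) (C : coalgebra K) (e : idempotent_form C).
Implicit Types (M S E : comodule C) (phi : {scalar C}).

Lemma simple_torsion_free S (s : S) : simple_comod S -> torsion_free e S ->
  (forall phi, act e (act phi s) = 0) -> s = 0.
Proof.
move=> [_ Ssim] /torsion_freeP[t et].
have [|||U UP] := @subcomod_ex _ _ S (fun s : S => forall phi, act e (act phi s) = 0).
- by move=> phi; rewrite !act0.
- by move=> a u v u0 v0 phi; rewrite !act_is_linear u0 v0 scaler0 addr0.
- move=> psi u u0 phi; have [chi chiE] := act_conv_ex phi psi.
  by rewrite -chiE.
move=> /UP sU; have [h|h] := Ssim U; first exact: h.
by move: et; have /UP/(_ (counit C)) := h t; rewrite act_counit => ->; rewrite eqxx.
Qed.

(** Injectivity of E extends j along the unit, and the extension is injective because Q has no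
    nonzero torsion subcomodule. For maximality, the action of e sends the subcomodule M of all such
    m to S, so the adjunction gives a map from M to Q, which is then shown to be compatible with the
    inclusions in E. *)
Lemma section_in_envelope_ex S E (j : comod_hom S E) :
  simple_comod S -> torsion_free e S -> injective_envelope j ->
  let Q := section_functor (quotient_functor e S) in
  exists (eta : comod_hom S Q) (iota : comod_hom Q E),
  [/\ injective iota, forall s, iota (eta s) = j s,
      forall q, exists s, act e q = eta s &
      forall m, (forall phi, exists s, act e (act phi m) = j s) ->
        exists q, m = iota q].
Proof.
move=> Ssim Stf [Einj jinj jess] Q.
have [eta etaE etaP] := section_unit_ex e S.
have eta_inj : injective eta.
  have [eps epsE] := Ce_counit_ex e.
  apply/hom_injP => s etas; apply: simple_torsion_free => // phi.
  have /(congr1 (fun z : Q => tcontrr eps (\val z))) : eta (act phi s) = 0.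
    by rewrite act_hom etas linear0.
  rewrite etaE linear0 (@tcontrr_tmap _ _ _ _ _ _ _ eps e) //.
  move=> es; rewrite -act_e_idem.
  exact: (congr1 (fun v : quotient_functor e S => \val v) es).
have [iota iotaE] := Einj _ _ eta j eta_inj.
have iota_inj : injective iota.
  apply/hom_injP => q iq; apply: section_torsion_free => phi.
  have [s eqE] := etaP (act phi q); rewrite eqE.
  have js0 : j (act e s) = j 0.
    by rewrite -iotaE -eqE !act_hom iq !act0 linear0.
  by rewrite (jinj _ _ js0) linear0.
exists eta, iota; split=> // [q|m mP].
  by have [s ->] := etaP q; exists (act e s).
have [|||M MP] := @subcomod_ex _ _ E (fun m =>
    forall phi, exists s, act e (act phi m) = j s).
- by move=> phi; exists 0; rewrite !act0 linear0.
- move=> a u v uP vP phi; have [s us] := uP phi; have [t vt] := vP phi.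
  by exists (a *: s + t); rewrite !act_is_linear us vt linearP.
- move=> psi u uP phi; have [chi chiE] := act_conv_ex phi psi.
  by have [s us] := uP chi; exists s; rewrite -chiE.
have /choice[k0 k0E] (x : M) : exists s, j s = act e (sub_incl M x).
  by have [s sE] := (MP _).1 (valP x) (counit C); exists s; rewrite -sE act_counit.
have [|k kE] := @linear_ex _ M S k0.
  move=> a u v; apply: jinj; rewrite linearP !k0E -act_is_linear.
  by rewrite linearP.
have [|psi psiE] := @section_hom_ex _ _ e M (quotient_functor e S)
    (@eM_proj _ _ e S \o k).
  move=> x; apply: tcontrr_sep => f.
  have [|phi phiE] := @scalar_ex _ C (fun c => f (eCe_proj e c)).
    by move=> a u v; rewrite !linearP.
  transitivity (tcontrr f (tmap (@eM_proj _ _ e S) (eCe_proj e) (coact S (k x)))).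
    by congr tcontrr; apply: eM_coactE.
  rewrite !(@tcontrr_tmap _ _ _ _ _ _ _ f phi) //.
  apply: val_inj; apply: jinj.
  rewrite -[LHS]/(j (act e (act phi (k x)))) -[RHS]/(j (act e (k (act phi x)))) !act_hom.
  rewrite !kE !k0E act_hom act_e_idem; congr act.
  rewrite /act coact_actE (@tcontrr_tmap _ _ _ _ _ _ _ phi phi) // => c.
  by rewrite !phiE -[in RHS](eCe_proj_lact e).
have [||j' j'E] := @factor_inj _ _ S M E (sub_incl M) j.
- exact: val_inj.
- move=> s; have jsM : j s \in M.
    by apply/MP => phi; exists (act e (act phi s)); rewrite !act_hom.
  by exists (SubOf jsM).
have psij' s : psi (j' s) = eta s.
  apply: val_inj; rewrite psiE etaE comod_homP tmap_comp; apply: eq_tmap => // t.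
  rewrite /= -[RHS]eM_proj_act; congr (eM_proj e _); apply: jinj.
  by rewrite kE k0E j'E act_hom.
(* The difference d of the two maps from M to E vanishes on S and so on eM; its image is torsion,
   meets the essential subcomodule S trivially, and is therefore 0. *)
have [h hE] := comp_hom_ex psi iota.
have [d dE] := sub_hom_ex h (sub_incl M).
have dj' s : d (j' s) = 0 by rewrite dE hE psij' iotaE j'E subrr.
have ed x : act e (d x) = 0.
  rewrite -act_hom -[RHS](dj' (k0 x)); congr (d _); apply: val_inj.
  by rewrite -[LHS]/(sub_incl M (act e x)) act_hom -k0E -j'E.
have [U UP] := hom_img_ex d.
have d0 x : d x = 0.
  apply: (jess U); last by apply/UP; exists x.
  move=> s /UP[y jsE].
  suff -> : s = 0 by rewrite linear0.
  apply: simple_torsion_free => // phi; apply: jinj.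
  by rewrite !act_hom jsE -act_hom ed linear0.
have mM : m \in M by apply/MP.
exists (psi (SubOf mM)); apply/eqP; rewrite -subr_eq0 -oppr_eq0 opprB.
by have := d0 (SubOf mM); rewrite dE hE => ->.
Qed.

End Envelope.

(** * Loewy layers of S(S_x) and paths in the Ext-quiver *)

Section Path.
Context (K : fieldType) (C : coalgebra K).
Implicit Types (M N X A B : comodule C).

Lemma bij_hom_inv A B (f : comod_hom A B) : bijective f ->
  exists2 g : comod_hom B A, injective g & forall b, f (g b) = b.
Proof.
move=> [f' fK f'K].
have [||||g gE] := @hom_of_graph _ _ B A (fun b a => f a = b).
- by move=> b; exists (f' b).
- by move=> a; rewrite -(linear0 f) => /(can_inj fK).
- by move=> a b x b' x' <- <-; rewrite linearP.
- by move=> phi b x <-; rewrite act_hom.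
by exists g => // b b' /(congr1 f); rewrite !gE.
Qed.

Lemma ext1_iso A B B' : comod_iso B B' -> Ext1_neq0 A B -> Ext1_neq0 A B'.
Proof.
move=> [f fbij] [X Xns]; have [g ginj fg] := bij_hom_inv fbij.
have [i iE] := comp_hom_ex g (ext_inj X).
have iinj : injective i.
  by move=> a b; rewrite !iE => /(@ext_inj_inj _ _ _ _ X)/ginj.
have exact x : ext_proj X x = 0 <-> exists b, x = i b.
  rewrite ext_exact; split=> [[b ->]|[b ->]]; last by exists (g b).
  by exists (f b); rewrite iE; congr (ext_inj X _); apply: (bij_inj fbij); rewrite fg.
by exists (Extension iinj (@ext_proj_surj _ _ _ _ X) exact).
Qed.

Lemma schur A B (f : comod_hom A B) a :
  simple_comod A -> simple_comod B -> f a != 0 -> comod_iso A B.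
Proof.
move=> Asim [_ Bsim] fa; exists f; have finj := simple_hom_inj Asim fa.
have [U UP] := hom_img_ex f; have [h|h] := Bsim U.
  by move/eqP: fa; case; apply: h; apply/UP; exists a.
have /choice[g gE] b : exists x, b = f x by apply/UP.
by exists g => x; [apply: finj; rewrite -gE|rewrite -gE].
Qed.

(** By essentiality the image of B meets that of A, hence contains it; Schur's lemma concludes. *)
Lemma envelope_simple A B E (j : comod_hom A E) (f : comod_hom B E) :
  simple_comod A -> simple_comod B -> injective_envelope j -> injective f ->
  comod_iso A B.
Proof.
move=> Asim Bsim [_ jinj jess] finj; have [[b b0] _] := Bsim.
have [U UP] := hom_img_ex f.
have [h|h] := Asim.2 (preim_subcomod j U).
  have fb : f b = 0.
    apply: (jess U); last by apply/UP; exists b.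
    by move=> a jaU; rewrite (h a) ?linear0.
  by move: b0; rewrite -(inj_eq finj) fb linear0 eqxx.
have [|u uE] := @factor_inj _ _ A B E f j finj.
  by move=> a; have /UP[b' ->] : j a \in U := h a; exists b'.
have [[a a0] _] := Asim; apply: (schur (f := u) (a := a)) => //.
by apply: contraNneq a0 => ua; apply/eqP/jinj; rewrite -uE ua !linear0.
Qed.

Section Torsion.
Context (e : idempotent_form C) (A Q E : comodule C) (j : comod_hom A E)
  (eta : comod_hom A Q) (iota : comod_hom Q E).
Context (Asim : simple_comod A) (jenv : injective_envelope j)
  (iota_inj : injective iota) (etaE : forall q, exists a, act e q = eta a).

(** eQ lies in the image of A, so in the socle of Q, and vanishes in the quotient. *)
Lemma embed_loewy_torsion B n :
  comod_embeds B (quot_comod (loewy Q n.+1)) -> torsion e B.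
Proof.
move=> [s sinj]; apply/torsionP => b; apply: sinj; rewrite linear0 act_hom.
have [q <-] := quot_proj_surj (s b); rewrite -act_hom; apply/quot_projE.
by have [a ->] := etaE q; apply/socle_loewy/simple_img_socle.
Qed.

Lemma embed_loewy_predecessor B n : simple_comod B ->
  comod_embeds B (quot_comod (loewy Q n.+1)) -> predecessor n.+1 B E.
Proof.
move=> Bsim [s sinj].
have [g ginj _] := quot_inj_ex (fun q => loewy_inj n.+1 q iota_inj).
have [h hE] := comp_hom_ex s g; apply: (ext1_quot_socle (s := h)) => //.
  by move=> m; apply: socle_loewy.
by move=> a b; rewrite !hE => /ginj/sinj.
Qed.

Lemma embed_loewy0_iso B : simple_comod B ->
  comod_embeds B (quot_comod (loewy Q 0)) -> comod_iso A B.
Proof.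
move=> Bsim [s sinj].
have pinj : injective (quot_proj (loewy Q 0)).
  by apply/hom_injP => q /quot_projE; rewrite inE => /eqP.
have [|u uE] := factor_inj (t := s) pinj.
  by move=> b; have [q <-] := quot_proj_surj (s b); exists q.
have [f fE] := comp_hom_ex u iota; apply: (envelope_simple (f := f) Asim Bsim jenv).
by move=> b b'; rewrite !fE => /iota_inj ub; apply: sinj; rewrite -!uE ub.
Qed.

(** Each step down the Loewy series of Q yields, by [ext1_simple_sub], an arrow to a simple comodule
    one layer lower. At layer 0 only S_x embeds, and the path is trivial. *)
Lemma embed_loewy_path (I : Type) (S : I -> comodule C) x y n :
  complete_simples S -> S x = A ->
  comod_embeds (S y) (quot_comod (loewy Q n)) ->
  ext_path_through S (fun z => torsion e (S z)) n y x.
Proof.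
move=> [Ssim Siso Sall] SxA; elim: n y => [|n IH] y.
  move=> /(embed_loewy0_iso (Ssim y)); rewrite -SxA => /Siso<-.
  by exists (fun=> x); split=> // -[].
move=> [s sinj]; have [g ginj _] := loewy_quot_ex Q n.
have [t tE] := comp_hom_ex s g.
have [|T Tsim ExtT] := ext1_simple_sub (s := t) (Ssim y).
  by move=> a b; rewrite !tE => /ginj/sinj.
have [z Tz] := Sall T Tsim.
have zQ : comod_embeds (S z) (quot_comod (loewy Q n)).
  have [f /bij_hom_inv[f' f'inj _]] := Tz.
  have [h hE] := comp_hom_ex f' (sub_incl T).
  by exists h => a b; rewrite !hE => /val_inj/f'inj.
have [p [p0 pn parr ptor]] := IH z zQ.
exists (fun i => if i == n.+1 then y else p i); rewrite eqxx; split=> // i.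
  rewrite ltnS eqSS leq_eqVlt => /orP[/eqP->|lt_in].
    by rewrite eqxx ltn_eqF // pn; apply: ext1_iso Tz ExtT.
  by rewrite (ltn_eqF lt_in) (ltn_eqF (leqW lt_in)); apply: parr.
rewrite ltnS => /andP[i0]; rewrite leq_eqVlt => /orP[/eqP iE|lt_in].
  (* The former endpoint z becomes interior only when n > 0, and then it is torsion as it embeds
     above the socle. *)
  rewrite ltn_eqF ?iE // pn; move: i0 zQ; rewrite iE; case: (n) => // m _.
  exact: embed_loewy_torsion.
by rewrite (ltn_eqF (leqW lt_in)); apply: ptor; rewrite i0.
Qed.

Context (iota_eta : forall a, iota (eta a) = j a)
  (iota_max : forall m,
    (forall phi, exists a, act e (act phi m) = j a) -> exists q, m = iota q).

(* Heredity makes [E / iota (Soc^n Q)] injective, so an extension of [B] by   *)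
(* [A'] maps to it; if [B] is torsion, the image stays inside that of [Q].    *)
Lemma embed_loewyS A' B n :
  hereditary_coalg C -> simple_comod A' -> simple_comod B -> torsion e B ->
  Ext1_neq0 B A' -> comod_embeds A' (quot_comod (loewy Q n)) ->
  comod_embeds B (quot_comod (loewy Q n.+1)).
Proof.
move=> hered A'sim Bsim /torsionP Btor [X Xns] [s sinj].
have [Einj _ _] := jenv.
have [|||U UP] := @subcomod_ex _ _ E (fun v => exists2 q, q \in loewy Q n & v = iota q).
- by exists 0; rewrite ?rpred0 ?linear0.
- move=> a _ _ [q qQ ->] [q' qQ' ->]; exists (a *: q + q'); last by rewrite linearP.
  by rewrite rpredD ?rpredZ.
- by move=> phi _ [q qQ ->]; exists (act phi q); rewrite ?act_hom ?act_subcomod.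
have [|h hinj hE] := @quot_inj_ex _ _ Q E iota (loewy Q n) U.
  move=> q; split=> [qQ|/UP[q' q'Q /iota_inj->]//].
  by apply/UP; exists q.
have [f fE] := comp_hom_ex s h.
have [g gE] := hered _ Einj U _ _ (ext_inj X) f (@ext_inj_inj _ _ _ _ X).
have ginj : injective g.
  apply: (nonsplit_hom_inj (X := X)) => // b; rewrite gE fE => hs.
  by apply: sinj; apply: hinj; rewrite hs !linear0.
(* As B is torsion, e sends X into A', hence m into Q modulo U; a second e lands in S_x, and
   maximality of Q applies. *)
have gQ x : exists a, g x = h a.
  have [m mE] := quot_proj_surj (g x).
  suff /iota_max[q mq] : forall phi, exists a, act e (act phi m) = j a.
    by exists (quot_proj _ q); rewrite hE -mq mE.
  move=> phi; have /ext_exact[b bE] : ext_proj X (act e (act phi x)) = 0.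
    by rewrite act_hom Btor.
  have [q qE] := quot_proj_surj (s b).
  have /quot_projE/UP[q' _ q'E] : quot_proj U (act e (act phi m) - iota q) = 0.
    by rewrite linearB !act_hom mE -hE qE -!act_hom bE gE fE subrr.
  have [a aE] := etaE (q' + q); exists a.
  rewrite -iota_eta -aE act_hom linearD -q'E subrK.
  exact/esym/act_idem.
have [g' g'E] := factor_inj hinj gQ.
have g'inj : injective g' by move=> a b ab; apply: ginj; rewrite -!g'E ab.
have [|r rE] := @factor_surj _ _ _ _ _ (quot_proj (loewy Q n))
    (quot_proj (loewy Q n.+1)) (@quot_proj_surj _ _ _ _).
  by move=> q /quot_projE/loewy_mono/quot_projE.
have r0 z : r z = 0 <-> z \in comod_socle (quot_comod (loewy Q n)).
  by have [q <-] := quot_proj_surj z; rewrite rE quot_projE loewyS.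
have [t tE] := comp_hom_ex g' r.
have [|u uE] := factor_surj (t := t) (@ext_proj_surj _ _ _ _ X).
  move=> _ /ext_exact[b ->]; rewrite tE; apply/r0.
  have [k kE] := comp_hom_ex (ext_inj X) g'.
  by rewrite -kE; apply: simple_img_socle.
exists u; apply/hom_injP => b; have [x <-] := ext_proj_surj X b.
(* If u kills the class of x, then x lies in the socle of X, so its class in B is 0. *)
rewrite uE tE => /r0/(socle_inj g'inj); exact: nonsplit_socle.
Qed.

End Torsion.
End Path.

Local Close Scope ring_scope.

Theorem theorem3p10 (K : fieldType) (C : coalgebra K) (I : Type)
    (S E : I -> comodule C) (j : forall z, comod_hom (S z) (E z))
    (e : idempotent_form C) (x y : I) (n : nat) :
  basic_coalg C ->
  complete_simples S ->
  (forall z, injective_envelope (j z)) ->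
  ext_connected S ->
  torsion_free e (S x) ->
  0 < n ->
  let SSx := section_functor (quotient_functor e (S x)) in
  let Sy_in_quotient := comod_embeds (S y) (quot_comod (loewy SSx n)) in
  let a := torsion e (S y) in
  let b := predecessor n (S y) (E x) in
  let c := ext_path_through S (fun z => torsion e (S z)) n y x in
  (Sy_in_quotient -> [/\ a, b & c]) /\
  (hereditary_coalg C -> [/\ a, b & c] -> Sy_in_quotient).
Proof.
move=> _ Sall jenv _ Stf n0 SSx Sy_in_quotient a b c.
have [Ssim _ _] := Sall.
have [eta [iota [iota_inj iota_eta etaE iota_max]]] :=
  section_in_envelope_ex (Ssim x) Stf (jenv x).
case: n n0 @Sy_in_quotient @b @c => // n _ Sy_in_quotient b c; split=> [Sy|].
  split; first exact: (embed_loewy_torsion (Ssim x) etaE Sy).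
    exact: (embed_loewy_predecessor iota_inj (Ssim y) Sy).
  exact: (embed_loewy_path (Ssim x) (jenv x) iota_inj etaE Sall).
move=> hered [ytor _ [p [p0 pn parr ptor]]].
(* Induction along the path from S_x, which embeds in Q/Soc^0 Q by the unit. *)
suff H i : i <= n.+1 -> comod_embeds (S (p i)) (quot_comod (loewy SSx i)).
  by rewrite /Sy_in_quotient -pn; apply: H.
elim: i => [_|i IH lt_in].
  have [h hE] := comp_hom_ex eta (quot_proj (loewy SSx 0)).
  rewrite p0; exists h; apply/hom_injP => s; rewrite hE => /quot_projE.
  rewrite inE => /eqP es; have [_ jinj _] := jenv x.
  by apply: jinj; rewrite -iota_eta es !GRing.linear0.
(* The endpoint is torsion by (a), the interior vertices by (c). *)
have itor : torsion e (S (p i.+1)).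
  have [->|ne_in] := eqVneq i n; first by rewrite pn.
  by apply: ptor; rewrite /= ltnS ltn_neqAle ne_in.
apply: (embed_loewyS (jenv x) iota_inj etaE iota_eta iota_max hered
  (Ssim (p i)) _ itor) => //.
- exact: parr.
- exact/IH/ltnW.
Qed.
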